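(* Fix $\mathfrak{A}\in GL_n(F)^n$, a homogeneous polynomial $P$, $\mathbf{u}\in F^n$, $M\in R_n$ and $k\in\mathbb{Z}$. Then the series $$\Psi_s(\mathfrak{A})(P,\mathbf{u},M)=\sum_{x\in\mathbf{\Lambda}+\mathbf{u}}\psi(\mathfrak{A})(P,x)\,\Omega_s^k(x,M)$$ converges absolutely for $\mathrm{Re}(s)>1+\tfrac{k}{2}$.
   Context: $F\subset\mathbb{C}$ imaginary quadratic with ring of integers $\mathcal{O}_F$; $\mathbf{\Lambda}=\Lambda_1\times\dots\times\Lambda_n$ with each $\Lambda_i$ a lattice in $F$ with multiplier ring $\mathcal{O}_F$; vectors in $F^n$ are rows. $\langle x,v\rangle=\sum_ix_iv_i$. For $\sigma\in M_n(\mathbb{C})$ with columns $\sigma_j$: $f(\sigma)(x)=\det\sigma/\prod_j\langle x,\sigma_j\rangle$ if all $\langle x,\sigma_j\rangle\ne0$, else $0$; $f(\sigma)(P,x)=P(-\partial_{x_1},\dots,-\partial_{x_n})f(\sigma)(x)$ (and $0$ where some $\langle x,\sigma_j\rangle=0$). For $\mathfrak{A}=(A_1,\dots,A_n)$ with $A_{kj}$ the $j$-th column of $A_k$ and $x\ne0$, $j_k$ is the smallest index with $\langle x,A_{kj_k}\rangle\ne0$ and $\psi(\mathfrak{A})(P,x)=f(A_{1j_1},\dots,A_{nj_n})(P,x)$; $\psi(\mathfrak{A})(P,0)=0$. $R_n$: matrices $M\in GL_n(\mathbb{C})$ with $(i,j)$ entry $\rho_j(m_i)$ for a degree-$n$ extension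 $K/F$, distinct embeddings $\rho_j:K\to\mathbb{C}$ fixing $F$, $m_i\in K$; $M_i$ is its $i$-th column. $\Omega_s^k(x,M)=\prod_i\overline{xM_i}^{\,k}/|xM_i|^{2s}$. *)

(* Defs.v *)
From Stdlib Require Import Reals Lra ZArith QArith Qreals List ClassicalEpsilon.
Import ListNotations.
Open Scope R_scope.

Record Cx := mkC { re : R; im : R }.

Definition C0 : Cx := mkC 0 0.
Definition C1 : Cx := mkC 1 0.
Definition RtoC (r : R) : Cx := mkC r 0.
Definition Cadd (z w : Cx) : Cx := mkC (re z + re w) (im z + im w).
Definition Copp (z : Cx) : Cx := mkC (- re z) (- im z).
Definition Csub (z w : Cx) : Cx := Cadd z (Copp w).
Definition Cmul (z w : Cx) : Cx :=
  mkC (re z * re w - im z * im w) (re z * im w + im z * re w).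
Definition Cconj (z : Cx) : Cx := mkC (re z) (- im z).
Definition Cnorm2 (z : Cx) : R := re z * re z + im z * im z.
Definition Cabs (z : Cx) : R := sqrt (Cnorm2 z).
Definition Cinv (z : Cx) : Cx := mkC (re z / Cnorm2 z) (- im z / Cnorm2 z).
Definition Cdiv (z w : Cx) : Cx := Cmul z (Cinv w).

Fixpoint Cpow_nat (z : Cx) (m : nat) : Cx :=
  match m with O => C1 | S m' => Cmul z (Cpow_nat z m') end.

Definition Cpow_int (z : Cx) (k : Z) : Cx :=
  match k with
  | Z0 => C1
  | Zpos p => Cpow_nat z (Pos.to_nat p)
  | Zneg p => Cinv (Cpow_nat z (Pos.to_nat p))
  end.

Definition Rcpow (r : R) (s : Cx) : Cx :=
  mkC (exp (re s * ln r) * cos (im s * ln r)) (exp (re s * ln r) * sin (im s * ln r)).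

Definition nonzeroC (z : Cx) : bool :=
  if Req_EM_T (re z) 0 then (if Req_EM_T (im z) 0 then false else true) else true.

Definition Csum (n : nat) (f : nat -> Cx) : Cx := fold_right Cadd C0 (map f (seq 0 n)).
Definition Cprod (n : nat) (f : nat -> Cx) : Cx := fold_right Cmul C1 (map f (seq 0 n)).

(* ---------- Vectors and matrices (entries indexed by nat; only i < n matter) ---------- *)
Definition vec := nat -> Cx.
Definition mat := nat -> nat -> Cx.

Definition col (A : mat) (j : nat) : vec := fun i => A i j.

Definition inner (n : nat) (x v : vec) : Cx := Csum n (fun i => Cmul (x i) (v i)).

Definition minor (A : mat) (j : nat) : mat :=
  fun r c => A (S r) (if Nat.ltb c j then c else S c).

Fixpoint det (n : nat) (A : mat) : Cx :=
  match n with
  | O => C1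
  | S n' => Csum (S n') (fun j =>
      Cmul (Cpow_nat (Copp C1) j) (Cmul (A O j) (det n' (minor A j))))
  end.

Definition nonzero_vec (n : nat) (x : vec) : Prop := exists i, (i < n)%nat /\ x i <> C0.

Definition upd (x : vec) (i : nat) (z : Cx) : vec :=
  fun m => if Nat.eqb m i then z else x m.

Definition is_partial (i : nat) (g : vec -> Cx) (x : vec) (L : Cx) : Prop :=
  forall eps, eps > 0 -> exists delta, delta > 0 /\
    forall h : Cx, h <> C0 -> Cabs h < delta ->
      Cabs (Csub (Cdiv (Csub (g (upd x i (Cadd (x i) h))) (g x)) h) L) < eps.

(* the partial derivative (its value is only ever used where it exists) *)
Definition Cpartial (i : nat) (g : vec -> Cx) : vec -> Cx :=
  fun x => epsilon (inhabits C0) (fun L => is_partial i g x L).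

Fixpoint iter_partial (i m : nat) (g : vec -> Cx) : vec -> Cx :=
  match m with O => g | S m' => Cpartial i (iter_partial i m' g) end.

Definition Dalpha (n : nat) (alpha : nat -> nat) (g : vec -> Cx) : vec -> Cx :=
  fold_right (fun i h => iter_partial i (alpha i) h) g (seq 0 n).

(* a polynomial is a finite list of monomials (coefficient, exponent vector) *)
Definition mpoly := list (Cx * (nat -> nat)).
Definition total_deg (n : nat) (alpha : nat -> nat) : nat :=
  fold_right Nat.add O (map alpha (seq 0 n)).
Definition homogeneous (n : nat) (P : mpoly) : Prop :=
  exists dg : nat, forall m, In m P -> total_deg n (snd m) = dg.

Definition all_cols_nonzero (n : nat) (x : vec) (sigma : mat) : bool :=
  forallb (fun j => nonzeroC (inner n x (col sigma j))) (seq 0 n).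

Definition fsig (n : nat) (sigma : mat) : vec -> Cx :=
  fun x => if all_cols_nonzero n x sigma
           then Cdiv (det n sigma) (Cprod n (fun j => inner n x (col sigma j)))
           else C0.

(* f(sigma)(P,x) = P(-d_{x_1},...,-d_{x_n}) f(sigma)(x), and 0 on the hyperplanes *)
Definition fsigP (n : nat) (sigma : mat) (P : mpoly) : vec -> Cx :=
  fun x => if all_cols_nonzero n x sigma
           then fold_right Cadd C0
                  (map (fun m => Cmul (fst m)
                        (Cmul (Cpow_nat (Copp C1) (total_deg n (snd m)))
                              (Dalpha n (snd m) (fsig n sigma) x))) P)
           else C0.

Definition first_nz (n : nat) (x : vec) (A : mat) : nat :=
  match find (fun j => nonzeroC (inner n x (col A j))) (seq 0 n) with
  | Some j => j | None => O end.

Definition psi (n : nat) (frakA : nat -> mat) (P : mpoly) (x : vec) : Cx :=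
  if forallb (fun i => negb (nonzeroC (x i))) (seq 0 n) then C0
  else fsigP n (fun r c => frakA c r (first_nz n x (frakA c))) P x.

Definition Omega (n : nat) (s : Cx) (k : Z) (x : vec) (M : mat) : Cx :=
  Cprod n (fun i => let w := inner n x (col M i) in
    Cdiv (Cpow_int (Cconj w) k) (Rcpow (Cabs w) (Cmul (RtoC 2) s))).

Definition QtoC (q : Q) : Cx := RtoC (Q2R q).
Definition sqrt_md (d : nat) : Cx := mkC 0 (sqrt (INR d)).
Definition inF (d : nat) (z : Cx) : Prop :=
  exists a b : Q, z = Cadd (QtoC a) (Cmul (QtoC b) (sqrt_md d)).

Definition integral_over_Z (z : Cx) : Prop :=
  exists cs : list Z,
    Cadd (Cpow_nat z (length cs))
         (Csum (length cs) (fun i => Cmul (RtoC (IZR (nth i cs 0%Z))) (Cpow_nat z i))) = C0.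

Definition inOF (d : nat) (z : Cx) : Prop := inF d z /\ integral_over_Z z.

Definition ZtoC (a : Z) : Cx := RtoC (IZR a).

(* a lattice in F: Z w1 + Z w2 with w1, w2 in F linearly independent over R *)
Definition is_lattice_F (d : nat) (L : Cx -> Prop) : Prop :=
  exists w1 w2, inF d w1 /\ inF d w2 /\ im (Cmul (Cconj w1) w2) <> 0 /\
    forall z, L z <-> exists a b : Z, z = Cadd (Cmul (ZtoC a) w1) (Cmul (ZtoC b) w2).

Definition multiplier_ring_is_OF (d : nat) (L : Cx -> Prop) : Prop :=
  forall a, (inF d a /\ forall z, L z -> L (Cmul a z)) <-> inOF d a.

Definition in_GLn_F (d n : nat) (A : mat) : Prop :=
  (forall r c, (r < n)%nat -> (c < n)%nat -> inF d (A r c)) /\ det n A <> C0.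

(* K is realised as a subfield of C (its image under one embedding) *)
Definition subfield_containing_F (d : nat) (K : Cx -> Prop) : Prop :=
  (forall z, inF d z -> K z) /\
  (forall z w, K z -> K w -> K (Cadd z w)) /\
  (forall z w, K z -> K w -> K (Cmul z w)) /\
  (forall z, K z -> K (Copp z)) /\
  (forall z, K z -> z <> C0 -> K (Cinv z)).

Definition degree_over_F (d : nat) (K : Cx -> Prop) (n : nat) : Prop :=
  exists b : nat -> Cx, (forall i, (i < n)%nat -> K (b i)) /\
    (forall z, K z -> exists c : nat -> Cx,
        (forall i, (i < n)%nat -> inF d (c i)) /\ z = Csum n (fun i => Cmul (c i) (b i))) /\
    (forall c : nat -> Cx, (forall i, (i < n)%nat -> inF d (c i)) ->
        Csum n (fun i => Cmul (c i) (b i)) = C0 -> forall i, (i < n)%nat -> c i = C0).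

Definition embedding_fixing_F (d : nat) (K : Cx -> Prop) (rho : Cx -> Cx) : Prop :=
  (forall z w, K z -> K w -> rho (Cadd z w) = Cadd (rho z) (rho w)) /\
  (forall z w, K z -> K w -> rho (Cmul z w) = Cmul (rho z) (rho w)) /\
  rho C1 = C1 /\
  (forall z, inF d z -> rho z = z).

Definition in_Rn (d n : nat) (M : mat) : Prop :=
  det n M <> C0 /\
  exists (K : Cx -> Prop) (rho : nat -> Cx -> Cx) (m : nat -> Cx),
    subfield_containing_F d K /\ degree_over_F d K n /\
    (forall j, (j < n)%nat -> embedding_fixing_F d K (rho j)) /\
    (forall j j', (j < n)%nat -> (j' < n)%nat -> j <> j' ->
        exists z, K z /\ rho j z <> rho j' z) /\
    (forall i, (i < n)%nat -> K (m i)) /\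
    (forall i j, (i < n)%nat -> (j < n)%nat -> M i j = rho j (m i)).

Definition in_shifted_lattice (n : nat) (Lam : nat -> Cx -> Prop) (u x : vec) : Prop :=
  (forall i, (i < n)%nat -> Lam i (Csub (x i) (u i))) /\
  (forall i, (n <= i)%nat -> x i = C0).

Definition abs_summable_on (S : vec -> Prop) (a : vec -> Cx) : Prop :=
  exists B : R, forall l : list vec, NoDup l -> (forall x, In x l -> S x) ->
    fold_right Rplus 0 (map (fun x => Cabs (a x)) l) <= B.

Definition Psi_term (n : nat) (frakA : nat -> mat) (P : mpoly) (s : Cx) (k : Z) (M : mat)
  (x : vec) : Cx := Cmul (psi n frakA P x) (Omega n s k x M).

(* Main.v *)
From Stdlib Require Import Reals Lra Lia ZArith QArith Qreals List ClassicalEpsilon.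
From HB Require Import structures.
From mathcomp Require boot.all_boot algebra.all_algebra fingroup.perm classical.boolp.
From mathcomp Require algebra_tactics.ring.
From Pilot Require Import Defs.
Open Scope R_scope.

(* Write w_i = <x, M_i>. The product of the w_i is, up to a bounded denominator, the norm
   of an algebraic integer, so it is bounded below by some c > 0 on nonzero lattice points x.
   Each factor <x, sigma_j> is likewise bounded below when it does not vanish, and by
   Cramer's rule max_j |<x, sigma_j>| dominates |det(sigma) x|; since every derivative of
   f(sigma) is f(sigma) times a polynomial in the 1/<x, sigma_j>, the factor psi(x) is at
   most a constant over max(1, max_i |w_i|). As the |w_i| have product >= c, this maximum
   controls all the |log |w_i||, and psi(x) decays like prod_i exp(- delta |log |w_i||).
   On the other hand |Omega(x)| <= C prod_i |w_i|^(-2), because 2 Re s - k > 2, and the box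
   |w_i| <= exp(t_i) contains only O(prod_i exp(2 t_i)) lattice points, by pigeonhole, since
   differences of lattice points also have norm at least c. Summing over boxes leaves the
   product over i of two geometric series of ratio exp(- delta). *)

(* Confined to a module: outside of it [(i < n)%nat] is the order of Stdlib. *)
Module PsiSeries.
Import mathcomp.boot.all_boot mathcomp.algebra.all_algebra mathcomp.fingroup.perm.
Import mathcomp.classical.boolp Pilot.Defs.
Import GRing.Theory.
Set Implicit Arguments. Unset Strict Implicit. Unset Printing Implicit Defensive.
Local Open Scope R_scope.

(** * The field of complex numbers *)

Lemma Cx_eq (z w : Cx) : re z = re w -> im z = im w -> z = w.
Proof. by case: z w => a b [c d] /= -> ->. Qed.
HB.instance Definition _ := gen_eqMixin Cx.
HB.instance Definition _ := gen_choiceMixin Cx.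
Ltac cx := do ?[move=> ?]; apply: Cx_eq; rewrite /=; ring.
Lemma CaddA : associative Cadd. Proof. cx. Qed.
Lemma CaddC : commutative Cadd. Proof. cx. Qed.
Lemma Cadd0 : left_id C0 Cadd. Proof. cx. Qed.
Lemma CaddN : left_inverse C0 Copp Cadd. Proof. cx. Qed.
HB.instance Definition _ := GRing.isZmodule.Build Cx CaddA CaddC Cadd0 CaddN.
Lemma CmulA : associative Cmul. Proof. cx. Qed.
Lemma CmulC : commutative Cmul. Proof. cx. Qed.
Lemma Cmul1 : left_id C1 Cmul. Proof. cx. Qed.
Lemma CmulDl : left_distributive Cmul Cadd. Proof. cx. Qed.
Lemma C1_neq0 : C1 != C0. Proof. apply/eqP; case; lra. Qed.
HB.instance Definition _ := GRing.Zmodule_isComNzRing.Build Cx CmulA CmulC Cmul1 CmulDl C1_neq0.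
Lemma Cnorm2_gt0 z : z <> C0 -> 0 < Cnorm2 z.
Proof.
move=> zN0; rewrite /Cnorm2; case: (Req_EM_T (re z) 0) => [r0|]; last by nra.
case: (Req_EM_T (im z) 0) => [i0|]; last by nra.
by case: zN0; apply: Cx_eq.
Qed.
Lemma CmulV (z : Cx) : z != 0%R -> Cmul (Cinv z) z = 1%R.
Proof.
move=> /eqP/Cnorm2_gt0 zgt0; rewrite /Cnorm2 in zgt0.
by apply: Cx_eq; rewrite /= /Cnorm2; field; lra.
Qed.
(** Both numerators vanish, so the value of the real inverse at 0 does not matter. *)
Lemma Cinv0 : Cinv 0%R = 0%R.
Proof. by apply: Cx_eq; rewrite /= /Cnorm2 /= /Rdiv; ring. Qed.
HB.instance Definition _ := GRing.ComNzRing_isField.Build Cx CmulV Cinv0.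
(** These structures open the [\big] lemmas on splitting and distributivity to the Stdlib reals,
    whose order stays that of [lra] and [nra]. *)
Lemma RplusA : associative Rplus. Proof. by move=> *; ring. Qed.
Lemma RplusC : commutative Rplus. Proof. by move=> *; ring. Qed.
Lemma Rplus0 : left_id 0 Rplus. Proof. by move=> *; ring. Qed.
HB.instance Definition _ := Monoid.isComLaw.Build R 0 Rplus RplusA RplusC Rplus0.
Lemma RmultA : associative Rmult. Proof. by move=> *; ring. Qed.
Lemma RmultC : commutative Rmult. Proof. by move=> *; ring. Qed.
Lemma Rmult1 : left_id 1 Rmult. Proof. by move=> *; ring. Qed.
HB.instance Definition _ := Monoid.isComLaw.Build R 1 Rmult RmultA RmultC Rmult1.
Lemma Rmult0l : left_zero 0 Rmult. Proof. by move=> *; ring. Qed.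
Lemma Rmult0r : right_zero 0 Rmult. Proof. by move=> *; ring. Qed.
HB.instance Definition _ := Monoid.isMulLaw.Build R 0 Rmult Rmult0l Rmult0r.
Lemma RmultDl : left_distributive Rmult Rplus. Proof. by move=> *; ring. Qed.
Lemma RmultDr : right_distributive Rmult Rplus. Proof. by move=> *; ring. Qed.
HB.instance Definition _ := Monoid.isAddLaw.Build R Rmult Rplus RmultDl RmultDr.
Lemma CaddE : Cadd = +%R. Proof. by []. Qed.
Lemma CmulE : Cmul = *%R. Proof. by []. Qed.
Lemma CoppE : Copp = @GRing.opp Cx. Proof. by []. Qed.
Lemma C0E : C0 = 0%R. Proof. by []. Qed.
Lemma C1E : C1 = 1%R. Proof. by []. Qed.
Lemma CsubE z w : Csub z w = (z - w)%R. Proof. by []. Qed.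
Lemma CdivE z w : Cdiv z w = (z / w)%R. Proof. by []. Qed.
Lemma CpowE z m : Cpow_nat z m = (z ^+ m)%R.
Proof. by elim: m => //= m ->; rewrite exprS. Qed.
Definition CE := (CaddE, CmulE, CoppE, C0E, C1E, CsubE, CdivE, CpowE).

(** * Sums, products and determinants as [\big] operators and matrices *)

Lemma nonzeroCE z : nonzeroC z = (z != 0%R).
Proof.
rewrite /nonzeroC; case: Req_EM_T => [r0|rN0]; last first.
  by apply/esym/eqP => z0; apply: rN0; rewrite z0.
case: Req_EM_T => [i0|iN0]; last by apply/esym/eqP => z0; apply: iN0; rewrite z0.
by apply/esym/negbTE/negPn/eqP; apply: Cx_eq.
Qed.

Lemma fold_seqE (T : Type) (z : T) (op : Monoid.law z) (f : nat -> T) a n :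
  fold_right op z (List.map f (List.seq a n)) = \big[op/z]_(i < n) f (a + i)%N.
Proof.
elim: n a => [|n IHn] a; first by rewrite big_ord0.
rewrite /= IHn big_ord_recl addn0; congr (op _ _).
by apply: eq_bigr => i _; rewrite /= /bump addSnnS.
Qed.

Lemma CsumE n f : Csum n f = (\sum_(i < n) f i)%R.
Proof. exact: (fold_seqE +%R). Qed.

Lemma CprodE n f : Cprod n f = (\prod_(i < n) f i)%R.
Proof. exact: (fold_seqE *%R). Qed.

Lemma innerE n x v : inner n x v = (\sum_(i < n) x i * v i)%R.
Proof. by rewrite /inner CsumE. Qed.

Lemma forallb_seqE (p : nat -> bool) n :
  reflect (forall i, (i < n)%N -> p i) (forallb p (List.seq 0 n)).
Proof.
apply: (iffP idP) => [/forallb_forall all_p i ltin|all_p].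
  by apply: all_p; apply/in_seq; split; [lia | apply/ltP].
by apply/forallb_forall => i /in_seq [_ /ltP]; exact: all_p.
Qed.

Definition mx_of n (A : mat) : 'M[Cx]_n := (\matrix_(i, j) A i j)%R.

(** Both sides expand along the first row; the column shift in [minor] is [bump]. *)
Lemma detE n A : det n A = (\det (mx_of n A))%R.
Proof.
elim: n A => [|n IHn] A; first by rewrite det_mx00.
rewrite [LHS]CsumE (expand_det_row _ ord0); apply: eq_bigr => j _.
cbv beta; rewrite -/(det n (minor A j)) IHn !CE /cofactor !mxE add0n mulrCA; do 2 congr (_ * _)%R.
congr (\det _)%R; apply/matrixP => r c; rewrite !mxE /minor /= /bump.
case: Nat.ltb_spec => [/ltP lt_cj|]; first by rewrite [(j <= c)%N]leqNgt lt_cj.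
by move=> /leP ->.
Qed.

(** * The complex absolute value *)

Lemma Cabs_ge0 z : 0 <= Cabs z. Proof. exact: sqrt_pos. Qed.

Lemma Cabs0 : Cabs 0%R = 0.
Proof. by rewrite /Cabs /Cnorm2 /= !Rmult_0_l Rplus_0_l sqrt_0. Qed.

Lemma Cabs1 : Cabs 1%R = 1.
Proof. by rewrite /Cabs /Cnorm2 /= Rmult_1_l Rmult_0_l Rplus_0_r sqrt_1. Qed.

Lemma Cnorm2_ge0 z : 0 <= Cnorm2 z. Proof. rewrite /Cnorm2; nra. Qed.

Lemma Cabs_gt0 z : z <> 0%R -> 0 < Cabs z.
Proof. by move=> /Cnorm2_gt0; exact: sqrt_lt_R0. Qed.

Lemma CabsM z w : Cabs (z * w)%R = Cabs z * Cabs w.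
Proof.
rewrite /Cabs -sqrt_mult; try exact: Cnorm2_ge0.
by congr sqrt; rewrite /Cnorm2 /=; ring.
Qed.

Lemma CabsN z : Cabs (- z)%R = Cabs z.
Proof. by rewrite /Cabs; congr sqrt; rewrite /Cnorm2 /=; ring. Qed.

Lemma Cabs_conj z : Cabs (Cconj z) = Cabs z.
Proof. by rewrite /Cabs; congr sqrt; rewrite /Cnorm2 /=; ring. Qed.

Lemma CabsV z : Cabs (z^-1)%R = / Cabs z.
Proof.
case: (pselect (z = 0%R)) => [->|zN0]; first by rewrite invr0 Cabs0 Rinv_0.
have zgt0 := Cabs_gt0 zN0.
apply: (Rmult_eq_reg_l (Cabs z)); last by lra.
by rewrite -CabsM divff ?Cabs1 ?Rinv_r //; [lra | apply/eqP].
Qed.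

Lemma Cabs_add z w : Cabs (z + w)%R <= Cabs z + Cabs w.
Proof.
apply: Rsqr_incr_0_var; last by move: (Cabs_ge0 z) (Cabs_ge0 w); lra.
have sq t : Rsqr (Cabs t) = Cnorm2 t by rewrite Rsqr_sqrt //; exact: Cnorm2_ge0.
rewrite Rsqr_plus !sq.
suff: re z * re w + im z * im w <= Cabs z * Cabs w by rewrite /Cnorm2 /=; nra.
apply: Rsqr_incr_0_var; last by move: (Cabs_ge0 z) (Cabs_ge0 w); nra.
rewrite Rsqr_mult !sq /Cnorm2 /Rsqr.
(* Lagrange's identity: this square is the gap in the Cauchy-Schwarz inequality. *)
have := Rle_0_sqr (re z * im w - im z * re w); rewrite /Rsqr; lra.
Qed.

Lemma Rabs_re_le z : Rabs (re z) <= Cabs z.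
Proof. by rewrite -sqrt_Rsqr_abs; apply: sqrt_le_1_alt; rewrite /Rsqr /Cnorm2; nra. Qed.

Lemma Rabs_im_le z : Rabs (im z) <= Cabs z.
Proof. by rewrite -sqrt_Rsqr_abs; apply: sqrt_le_1_alt; rewrite /Rsqr /Cnorm2; nra. Qed.

Lemma Cabs_le_reim z : Cabs z <= Rabs (re z) + Rabs (im z).
Proof.
apply: Rsqr_incr_0_var; last by move: (Rabs_pos (re z)) (Rabs_pos (im z)); lra.
rewrite Rsqr_sqrt; last exact: Cnorm2_ge0.
rewrite Rsqr_plus -!Rsqr_abs /Cnorm2 /Rsqr.
by move: (Rabs_pos (re z)) (Rabs_pos (im z)); nra.
Qed.

Lemma Cabs_prod n (F : 'I_n -> Cx) :
  Cabs (\prod_i F i)%R = \big[Rmult/1]_i Cabs (F i).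
Proof. by apply: (big_morph Cabs); [exact: CabsM | exact: Cabs1]. Qed.

Lemma Cabs_sum n (F : 'I_n -> Cx) :
  Cabs (\sum_i F i)%R <= \big[Rplus/0]_i Cabs (F i).
Proof.
elim/big_rec2: _ => [|i y z _ le_zy]; first by rewrite Cabs0; lra.
by have := Cabs_add (F i) y; lra.
Qed.

(** * Inequalities between finite real sums and products *)

Lemma Rsum_le (I : Type) (r : list I) (P : pred I) (F G : I -> R) :
  (forall i, P i -> F i <= G i) ->
  \big[Rplus/0]_(i <- r | P i) F i <= \big[Rplus/0]_(i <- r | P i) G i.
Proof.
move=> leFG; elim/big_rec2: _ => [|i y z Pi le_yz]; first by lra.
by have := leFG i Pi; lra.
Qed.

Lemma Rsum_ge0 (I : Type) (r : list I) (P : pred I) (F : I -> R) :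
  (forall i, P i -> 0 <= F i) -> 0 <= \big[Rplus/0]_(i <- r | P i) F i.
Proof.
move=> F0; elim/big_rec: _ => [|i y Pi y0]; first by lra.
by have := F0 i Pi; lra.
Qed.

Lemma Rprod_gt0 (I : Type) (r : list I) (P : pred I) (F : I -> R) :
  (forall i, P i -> 0 < F i) -> 0 < \big[Rmult/1]_(i <- r | P i) F i.
Proof.
move=> F0; elim/big_rec: _ => [|i y Pi y0]; first by lra.
by have := F0 i Pi; nra.
Qed.

Lemma Rprod_le (I : Type) (r : list I) (P : pred I) (F G : I -> R) :
  (forall i, P i -> 0 <= F i <= G i) ->
  \big[Rmult/1]_(i <- r | P i) F i <= \big[Rmult/1]_(i <- r | P i) G i.
Proof.
move=> leFG.
suff: 0 <= \big[Rmult/1]_(i <- r | P i) F i <= \big[Rmult/1]_(i <- r | P i) G i by case.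
elim/big_rec2: _ => [|i y z Pi le_yz]; first by lra.
by have := leFG i Pi; nra.
Qed.

Lemma exp_sum (I : Type) (r : list I) (P : pred I) (F : I -> R) :
  exp (\big[Rplus/0]_(i <- r | P i) F i) = \big[Rmult/1]_(i <- r | P i) exp (F i).
Proof. by apply: (big_morph exp); [exact: exp_plus | exact: exp_0]. Qed.

Lemma Rprod_const (n : nat) (a : R) : \big[Rmult/1]_(i < n) a = a ^ n.
Proof. by rewrite big_const card_ord; elim: n => //= n ->. Qed.

Lemma Rsum_const (I : finType) (P : pred I) (a : R) :
  \big[Rplus/0]_(i | P i) a = INR #|P| * a.
Proof.
rewrite big_const; elim: #|P| => [|m IHm]; first by rewrite /=; ring.
by rewrite iterS IHm S_INR; ring.
Qed.

Lemma Rsum_scale (I : Type) (r : list I) (P : pred I) (a : R) (F : I -> R) :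
  \big[Rplus/0]_(i <- r | P i) (a * F i) = a * \big[Rplus/0]_(i <- r | P i) F i.
Proof. by rewrite big_distrr. Qed.

Lemma le_Rsum_term (I : finType) (F : I -> R) (i : I) :
  (forall j, 0 <= F j) -> F i <= \big[Rplus/0]_j F j.
Proof.
move=> F0; rewrite (bigD1 i) //= -{1}[F i]Rplus_0_r.
by apply: Rplus_le_compat_l; apply: Rsum_ge0.
Qed.

(** * Sums over separated points *)

Definition nfloor (r : R) : nat := Z.to_nat (Int_part r).

Lemma nfloorP r : 0 <= r -> INR (nfloor r) <= r < INR (nfloor r) + 1.
Proof.
move=> r0; have [le_r lt_r] := base_Int_part r.
have: Z.le Z0 (Int_part r).
  suff: Z.lt (Zneg xH) (Int_part r) by lia.
  by apply: lt_IZR; lra.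
by move=> i0; rewrite /nfloor INR_IZR_INZ Z2Nat.id //; lra.
Qed.

Lemma nfloor_leq r m : r < INR m + 1 -> 0 <= r -> (nfloor r <= m)%N.
Proof.
move=> lt_rm /nfloorP[le_fr _]; apply/leP; apply: INR_le.
suff: (nfloor r < m.+1)%coq_nat by move=> lt_f; apply: le_INR; lia.
by apply: INR_lt; rewrite S_INR; lra.
Qed.

Lemma pow_lt_pow x y n : 0 <= x < y -> x ^ n.+1 < y ^ n.+1.
Proof.
move=> [x0 xy]; elim: n => [|n IHn]; first by rewrite !pow_1.
rewrite -(tech_pow_Rmult x) -(tech_pow_Rmult y).
by apply: Rmult_le_0_lt_compat => //; apply: pow_le.
Qed.

(** The interval [-E, E] is cut into pieces of length E / N. For |v| <= E the index is at most 2N,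
    the value 2N occurring only at v = E, so [inord] keeps it. *)
Definition cell (N : nat) (E v : R) : 'I_(N.*2).+1 :=
  inord (nfloor ((v / E + 1) * INR N)).

Lemma cell_close N E v v' : 0 < E -> (0 < N)%N -> Rabs v <= E -> Rabs v' <= E ->
  cell N E v = cell N E v' -> Rabs (v - v') <= E / INR N.
Proof.
move=> E0 N0 vE vE'.
have N0' : 0 < INR N by apply: lt_0_INR; apply/ltP.
have rng t : Rabs t <= E -> 0 <= (t / E + 1) * INR N < INR N.*2 + 1.
  move=> tE; have lo := Rle_abs t; have := Rle_abs (- t); rewrite Rabs_Ropp => hi.
  have q1 : -1 <= t / E <= 1.
    by split; apply: (Rmult_le_reg_r E) => //; rewrite /Rdiv Rmult_assoc Rinv_l; lra.
  by rewrite -addnn -plusE plus_INR; nra.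
have [lo hi] := rng v vE; have [lo' hi'] := rng v' vE'.
move=> /(congr1 val); rewrite /= !inordK ?ltnS; try exact: nfloor_leq.
move=> eqf; have [f1 f2] := nfloorP lo; have [f1' f2'] := nfloorP lo'.
rewrite -eqf in f1' f2'.
have d0 : Rabs ((v / E + 1) * INR N - (v' / E + 1) * INR N) <= 1 by apply: Rabs_le; lra.
have -> : v - v' = ((v / E + 1) * INR N - (v' / E + 1) * INR N) * (E / INR N).
  by field; lra.
have q0 : 0 < E / INR N by apply: Rdiv_lt_0_compat.
by rewrite Rabs_mult (Rabs_pos_eq (E / _)); nra.
Qed.

(* Pigeonhole: two points in the same cell would violate the separation hypothesis. *)
Lemma separated_card m n (w : 'I_m -> 'I_n -> Cx) (t : 'I_n -> R) (g : R)
  (S : pred 'I_m) : (0 < n)%N ->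
  (forall a i, S a -> Cabs (w a i) <= exp (t i)) ->
  (forall a b, a != b -> exp (- g) <= \big[Rmult/1]_i Cabs (w a i - w b i)%R) ->
  0 <= g + \big[Rplus/0]_i t i ->
  INR #|S| <= 49 ^ n * exp (2 * (g + \big[Rplus/0]_i t i)).
Proof.
move=> n0 wE sep; set T := (g + _) => T0.
have n0' : 0 < INR n by apply: lt_0_INR; apply/ltP.
(* Once N > 2p, points in one cell differ by less than exp (t i) / p in each coordinate, and p ^ n =
   exp T brings the product below exp (- g). *)
set p := exp (T / INR n).
have p1 : 1 <= p.
  have := exp_ineq1_le (T / INR n); have : 0 <= T / INR n by apply: Rle_mult_inv_pos.
  by rewrite /p; lra.
have pn : p ^ n = exp T.
  by rewrite /p -Rpower_pow ?/Rpower ?ln_exp; [congr exp; field; lra | exact: exp_pos].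
have [N1 N2] := @nfloorP (2 * p) ltac:(lra); set N := (nfloor (2 * p)).+1.
have NE : INR N = INR (nfloor (2 * p)) + 1 by rewrite S_INR.
pose key (a : 'I_m) := [ffun i : 'I_n => (cell N (exp (t i)) (re (w a i)),
                                          cell N (exp (t i)) (im (w a i)))].
have inj : {in S &, injective key}.
  move=> a b aS bS /ffunP eqk; apply/eqP/negPn/negP => /sep.
  apply: Rlt_not_le.
  apply: (@Rle_lt_trans _ (\big[Rmult/1]_(i < n) (exp (t i) * (2 / INR N)))).
    apply: Rprod_le => i _; split; first exact: Cabs_ge0.
    have := eqk i; rewrite !ffunE => -[eqre eqim].
    have cl f : Rabs (f (w a i)) <= Cabs (w a i) -> Rabs (f (w b i)) <= Cabs (w b i) ->
        cell N (exp (t i)) (f (w a i)) = cell N (exp (t i)) (f (w b i)) ->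
        Rabs (f (w a i) - f (w b i)) <= exp (t i) / INR N.
      move=> fa fb; apply: cell_close => //; first exact: exp_pos.
        by apply: Rle_trans fa _; apply: wE.
      by apply: Rle_trans fb _; apply: wE.
    have := cl re (Rabs_re_le _) (Rabs_re_le _) eqre.
    have := cl im (Rabs_im_le _) (Rabs_im_le _) eqim.
    have : Cabs (w a i - w b i)%R <=
        Rabs (re (w a i) - re (w b i)) + Rabs (im (w a i) - im (w b i)).
      exact: Cabs_le_reim.
    by rewrite /Rdiv; lra.
  rewrite big_split /= -exp_sum Rprod_const.
  have -> : - g = \big[Rplus/0]_i t i - T by rewrite /T; ring.
  rewrite /Rminus exp_plus; apply: Rmult_lt_compat_l; first exact: exp_pos.
  rewrite exp_Ropp -pn -pow_inv.
  have : 0 <= 2 / INR N < / p.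
    split; first by apply: Rle_mult_inv_pos; lra.
    apply: (Rmult_lt_reg_r (p * INR N)); first by nra.
    have -> : 2 / INR N * (p * INR N) = 2 * p by field; lra.
    by have -> : / p * (p * INR N) = INR N; [field; lra | lra].
  by case: (n) n0 => // n' _ /pow_lt_pow; apply.
have : (#|S| <= #|{ffun 'I_n -> 'I_(N.*2).+1 * 'I_(N.*2).+1}|)%N.
  by apply: leq_card_in inj.
rewrite card_ffun card_prod !card_ord => /leP/le_INR; move=> le_card.
apply: Rle_trans le_card _.
have -> : exp (2 * T) = (p ^ n) ^ 2 by rewrite pn /= Rmult_1_r -exp_plus; congr exp; ring.
rewrite -pow_mult Nat.mul_comm pow_mult -Rpow_mult_distr.
have -> k j : INR (k ^ j)%N = INR k ^ j.
  by elim: j => // j IH; rewrite expnS -multE mult_INR IH.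
(* Here 2N + 1 <= 4p + 3 <= 7p because p >= 1; the square of 7 is the constant 49. *)
apply: pow_incr; split; first exact: pos_INR.
rewrite -multE mult_INR S_INR -addnn -plusE plus_INR NE /= Rmult_1_r.
have := pos_INR (nfloor (2 * p)); nra.
Qed.

(** * The weighted sum over logarithmic boxes *)

Lemma geometric_le q B : 0 < q < 1 -> \big[Rplus/0]_(j < B) q ^ j <= / (1 - q).
Proof.
move=> q01; have -> : \big[Rplus/0]_(j < B) q ^ j = (1 - q ^ B) * / (1 - q).
  elim: B => [|B IHB]; first by rewrite big_ord0 /=; ring.
  by rewrite big_ord_recr IHB /=; field; lra.
have qB : 0 < q ^ B by apply: pow_lt; lra.
have : 0 < / (1 - q) by apply: Rinv_0_lt_compat; lra.
nra.
Qed.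

(** The pair of a sign and j encodes the reals r of that sign with j <= |r| < j + 1, and the value
    is the upper end of this interval. Cutting symmetrically about 0 makes j a lower bound of
    |r|. *)
Definition log_top (p : bool * nat) : R := if p.1 then INR p.2 + 1 else - INR p.2.

Definition log_key (r : R) : bool * nat := (`[< 0 <= r >], nfloor (Rabs r)).

Lemma log_keyP r : r <= log_top (log_key r) <= r + 1 /\ INR (log_key r).2 <= Rabs r.
Proof.
have [lo hi] := nfloorP (Rabs_pos r); rewrite /log_top /=.
case: asboolP => [r0|rN0]; first by rewrite Rabs_pos_eq // in lo hi *; lra.
by rewrite Rabs_left in lo hi *; lra.
Qed.

(** Group the points by the keys of their logarithms. A class whose tops sum to T has at most 49 ^ n
    exp (2 (g + T)) points, each of weight at most exp (2 (n - T)) times a product of powers of q =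
    exp (- del). T cancels, and the sum over keys factors over the coordinates. *)
Lemma lattice_sum_le m n (w : 'I_m -> 'I_n -> Cx) (g del : R) : (0 < n)%N -> 0 < del ->
  (forall a, - g <= \big[Rplus/0]_i ln (Cabs (w a i))) ->
  (forall a i, w a i <> 0%R) ->
  (forall a b, a != b -> exp (- g) <= \big[Rmult/1]_i Cabs (w a i - w b i)%R) ->
  \big[Rplus/0]_a \big[Rmult/1]_i
     exp (- 2 * ln (Cabs (w a i)) - del * Rabs (ln (Cabs (w a i))))
  <= 49 ^ n * exp (2 * (g + INR n)) * (2 / (1 - exp (- del))) ^ n.
Proof.
move=> n0 del0 normw wN0 sep; pose l a i := ln (Cabs (w a i)).
(* A bound on all indices makes the type of keys finite; the geometric bound is uniform in B. *)
pose B := (\max_a \max_i nfloor (Rabs (l a i)))%N.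
have leB a i : (nfloor (Rabs (l a i)) < B.+1)%N.
  by rewrite ltnS; apply: leq_trans (leq_bigmax a); exact: leq_bigmax i.
pose key a := [ffun i => ((log_key (l a i)).1, Ordinal (leB a i))].
pose top (f : {ffun 'I_n -> bool * 'I_B.+1}) i := log_top ((f i).1, (f i).2 : nat).
have keytop a i : top (key a) i = log_top (log_key (l a i)) by rewrite /top ffunE.
set q := exp (- del); have q01 : 0 < q < 1.
  by split; [exact: exp_pos | rewrite -exp_0; apply: exp_increasing; lra].
rewrite (partition_big key predT) //=.
apply: (@Rle_trans _ (\big[Rplus/0]_(f : {ffun 'I_n -> bool * 'I_B.+1})
    (49 ^ n * exp (2 * (g + INR n)) * \big[Rmult/1]_i q ^ (f i).2))); last first.
  rewrite Rsum_scale; apply: Rmult_le_compat_l.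
    by apply: Rmult_le_pos; [apply: pow_le; lra | left; exact: exp_pos].
  (* A sum over keys of products is a product of sums; the two signs give the 2 in 2 / (1 - q). *)
  rewrite -(bigA_distr_bigA (fun (_ : 'I_n) (p : bool * 'I_B.+1) => q ^ p.2)) Rprod_const.
  apply: pow_incr; split.
    by apply: Rsum_ge0 => i _; apply: pow_le; lra.
  rewrite -(pair_bigA _ (fun (_ : bool) (j : 'I_B.+1) => q ^ j)) /= big_bool /=.
  suff : \big[Rplus/0]_(j < B.+1) q ^ j <= / (1 - q).
    by set S := (X in X <= _) => leS; change (S + S <= 2 / (1 - q)); rewrite /Rdiv; lra.
  exact: geometric_le.
apply: Rsum_le => f _; set T := \big[Rplus/0]_i top f i.
set pr := \big[Rmult/1]_i _.
have pr0 : 0 < pr by apply: Rprod_gt0 => i _; apply: pow_lt; lra.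
have e0 := exp_pos.
(* Each logarithm is at least its top minus 1, and this rounding costs the factor exp (2 n). *)
apply: (@Rle_trans _ (\big[Rplus/0]_(a | key a == f) (exp (2 * (INR n - T)) * pr))).
  apply: Rsum_le => a /eqP keya.
  have -> : exp (2 * (INR n - T)) = \big[Rmult/1]_i exp (2 * (1 - top f i)).
    rewrite -exp_sum Rsum_scale big_split /=.
    by rewrite (Rsum_const predT) card_ord -(big_morph Ropp Ropp_plus_distr Ropp_0) Rmult_1_r.
  rewrite -big_split /=; apply: Rprod_le => i _; split; first by left.
  have -> : q ^ (f i).2 = exp (- del * INR (f i).2).
    by rewrite -Rpower_pow /Rpower ?ln_exp; [congr exp; ring | lra].
  rewrite -exp_plus; have [[_ top1] lefl] := log_keyP (l a i).
  rewrite -keytop keya in top1.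
  have -> : INR (f i).2 = INR (log_key (l a i)).2 by rewrite -keya ffunE.
  have le_exp u v : u <= v -> exp u <= exp v.
    by case=> [/exp_increasing|->]; lra.
  apply: le_exp; rewrite -/(l a i).
  have := Rmult_le_compat_l del _ _ (Rlt_le _ _ del0) lefl; lra.
rewrite Rsum_const.
(* An empty class contributes 0. In a nonempty one, the norm bound at a point [a0] yields 0 <= g +
   T, which the counting lemma requires. *)
have [|no_a] := pselect (exists a, key a = f); last first.
  rewrite eq_card0 => [|a]; last first.
    by apply/negP; rewrite unfold_in => /eqP keya; apply: no_a; exists a.
  rewrite /= Rmult_0_l; apply: Rmult_le_pos; last by left.
  by apply: Rmult_le_pos; [apply: pow_le; lra | left].
move=> [a0 keya0].
have := @separated_card m n w (top f) g (fun a => key a == f) n0.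
move=> /(_ _ sep _)-H.
have : INR #|(fun a => key a == f)| <= 49 ^ n * exp (2 * (g + T)).
  apply: H => [a i /eqP <-|].
    rewrite keytop; have [[ltop _] _] := log_keyP (l a i).
    rewrite -[Cabs (w a i)]exp_ln; last exact: Cabs_gt0.
    by case: ltop => [/exp_increasing|<-]; rewrite /l; lra.
  suff : \big[Rplus/0]_i ln (Cabs (w a0 i)) <= T by have := normw a0; rewrite -/T; lra.
  apply: Rsum_le => i _; rewrite -keya0 keytop.
  by have [[]] := log_keyP (l a0 i).
move=> le_card; apply: Rle_trans (Rmult_le_compat_r _ _ _ _ le_card) _.
  by apply: Rmult_le_pos; left.
have -> : 2 * (g + INR n) = 2 * (g + T) + 2 * (INR n - T) by ring.
by rewrite exp_plus; right; ring.
Qed.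

(** * Derivatives of products of reciprocals of linear forms *)

Module Derivatives.

(* [field] on [R] is needed below under another name, as the next import redefines it. *)
Ltac Rfield := field.
Import mathcomp.algebra_tactics.ring.

(** * Calculus of second-order expansions *)

Definition near0 (Q : Cx -> Prop) := exists e, 0 < e /\ forall h, Cabs h < e -> Q h.

Lemma near0_and Q1 Q2 : near0 Q1 -> near0 Q2 -> near0 (fun h => Q1 h /\ Q2 h).
Proof.
move=> [e1 [e10 h1]] [e2 [e20 h2]]; exists (Rmin e1 e2); split; first exact: Rmin_pos.
by move=> h lt_h; split; [apply: h1|apply: h2]; apply: Rlt_le_trans lt_h _;
  [exact: Rmin_l|exact: Rmin_r].
Qed.

Lemma near0_imp (Q1 Q2 : Cx -> Prop) : (forall h, Q1 h -> Q2 h) -> near0 Q1 -> near0 Q2.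
Proof. by move=> Q12 [e [e0 he]]; exists e; split=> // h /he/Q12. Qed.

Lemma near0_true (Q : Cx -> Prop) : (forall h, Q h) -> near0 Q.
Proof. by move=> HQ; exists 1; split; [lra|]. Qed.

Lemma near0_all n (Q : nat -> Cx -> Prop) : (forall j, (j < n)%N -> near0 (Q j)) ->
  near0 (fun h => forall j, (j < n)%N -> Q j h).
Proof.
elim: n => [|n IHn] nQ; first exact: near0_true.
have [|e [e0 he]] := near0_and (nQ n (ltnSn n)) (IHn _).
  by move=> j ltjn; apply: nQ; apply: ltnW.
exists e; split=> // h /he[Qn Qj] j; rewrite ltnS leq_eqVlt => /orP[/eqP->//|].
exact: Qj.
Qed.

Definition shift (x : vec) (i : nat) (h : Cx) : vec := upd x i (x i + h)%R.

Lemma shift0 x i : shift x i 0%R = x.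
Proof.
apply/funext => m; rewrite /shift /upd addr0.
by case: Nat.eqb_spec => [->|].
Qed.

(* Second-order expansion: a quantitative form of complex differentiability that is
   closed under products and inverses by pure algebra. *)
Definition expands (i : nat) (g : vec -> Cx) (x : vec) (L : Cx) :=
  exists (rho : Cx -> Cx) (B : R), near0 (fun h =>
    g (shift x i h) = (g x + h * L + h ^+ 2 * rho h)%R /\ Cabs (rho h) <= B).

Lemma expands_is_partial i g x L : expands i g x L -> is_partial i g x L.
Proof.
move=> [rho [B [e [e0 he]]]] eps eps0.
have B0 : 0 <= B.
  have [|_ leB] := he 0%R; first by rewrite Cabs0.
  by have := Cabs_ge0 (rho 0%R); lra.
(* The error of the difference quotient is h * rho h, of size at most |h| B; adding 1 covers B =
   0. *)
have q0 : 0 < eps / (B + 1) by apply: Rdiv_lt_0_compat; lra.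
exists (Rmin e (eps / (B + 1))); split; first exact: Rmin_pos.
move=> h hN0 lt_h.
have [geq leB] : g (shift x i h) = (g x + h * L + h ^+ 2 * rho h)%R /\ Cabs (rho h) <= B.
  by apply: he; apply: Rlt_le_trans lt_h _; exact: Rmin_l.
have {}lt_h : Cabs h * (B + 1) < eps.
  have := Rmult_lt_compat_r (B + 1) _ _ ltac:(lra) (Rlt_le_trans _ _ _ lt_h (Rmin_r _ _)).
  by have -> : eps / (B + 1) * (B + 1) = eps by Rfield; lra.
rewrite !CE -/(shift x i h) geq.
have -> : ((g x + h * L + h ^+ 2 * rho h - g x) / h - L = h * rho h)%R.
  by field; apply/eqP.
by rewrite CabsM; have := Cabs_ge0 h; nra.
Qed.

Lemma is_partial_unique i g x L L' : is_partial i g x L -> is_partial i g x L' -> L = L'.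
Proof.
move=> dL dL'; apply: contrapT => neq.
have dist0 : 0 < Cabs (L - L')%R.
  by apply: Cabs_gt0 => /eqP; rewrite subr_eq0 => /eqP.
have [e [e0 he]] := dL (Cabs (L - L')%R / 2) ltac:(lra).
have [e' [e0' he']] := dL' (Cabs (L - L')%R / 2) ltac:(lra).
have m0 : 0 < Rmin e e' by apply: Rmin_pos.
pose h := mkC (Rmin e e' / 2) 0.
have hE : Cabs h = Rmin e e' / 2.
  rewrite /Cabs /Cnorm2 /= Rmult_0_l Rplus_0_r sqrt_square //; lra.
have hN0 : h <> C0 by move=> [] ; lra.
have := he h hN0; have := he' h hN0; rewrite hE; rewrite !CsubE.
set D := Cdiv _ _ => h1 h2.
have {}h1 := h1 ltac:(have := Rmin_r e e'; lra).
have {}h2 := h2 ltac:(have := Rmin_l e e'; lra).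
have := Cabs_add (D - L')%R (- (D - L))%R; rewrite CabsN.
have -> : (D - L' + - (D - L) = L - L')%R by ring.
lra.
Qed.

(** [epsilon] picks some derivative as soon as one exists, and uniqueness identifies it. *)
Lemma Cpartial_eq i g x L : expands i g x L -> Cpartial i g x = L.
Proof.
move=> /expands_is_partial dL; rewrite /Cpartial.
apply: (@is_partial_unique i g x) => //.
by apply: epsilon_spec; exists L.
Qed.

(** Derivatives are local, so a function may be replaced by a formula valid off the hyperplanes. The
    neighbourhood contains h = 0, which matches the base values. *)
Lemma expands_ext i g g' x L : near0 (fun h => g (shift x i h) = g' (shift x i h)) ->
  expands i g' x L -> expands i g x L.
Proof.
move=> eqg [rho [B H]]; exists rho, B.
have gx : g x = g' x.
  have [e [e0 he]] := eqg; rewrite -[x](shift0 x i); apply: he.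
  by rewrite Cabs0.
by apply: near0_imp (near0_and eqg H) => h [-> [-> ?]]; rewrite gx.
Qed.

Lemma expands_cst i c x : expands i (fun=> c) x 0%R.
Proof.
exists (fun=> 0%R), 0; apply: near0_true => h; rewrite Cabs0; split; last by lra.
by rewrite !mulr0 !addr0.
Qed.

Lemma expands_add i f g x L L' : expands i f x L -> expands i g x L' ->
  expands i (fun y => f y + g y)%R x (L + L')%R.
Proof.
move=> [rho [B H]] [rho' [B' H']]; exists (fun h => rho h + rho' h)%R, (B + B').
apply: near0_imp (near0_and H H') => h [[-> leB] [-> leB']]; split; first by ring.
by have := Cabs_add (rho h) (rho' h); lra.
Qed.

Lemma Cabs_add_le z w a b : Cabs z <= a -> Cabs w <= b -> Cabs (z + w)%R <= a + b.
Proof. by have := Cabs_add z w; lra. Qed.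

Lemma expands_mul i f g x L L' : expands i f x L -> expands i g x L' ->
  expands i (fun y => f y * g y)%R x (L * g x + f x * L')%R.
Proof.
move=> [rho [B H]] [rho' [B' H']].
(* These are the terms of order at least 2 in the product of the expansions, divided by h ^ 2;
   restricting to |h| <= 1 bounds the leftover powers of h. *)
exists (fun h => f x * rho' h + g x * rho h + L * L' + h * (L * rho' h + L' * rho h)
                 + h ^+ 2 * (rho h * rho' h))%R.
exists (Cabs (f x) * B' + Cabs (g x) * B + Cabs (L * L')%R
        + (Cabs L * B' + Cabs L' * B) + B * B').
have small : near0 (fun h => Cabs h <= 1) by exists 1; split; [lra|move=> *; lra].
apply: near0_imp (near0_and small (near0_and H H')) => h [h1 [[-> leB] [-> leB']]].
split; [by ring | cbv beta].
have h0 := Cabs_ge0 h; have r0 := Cabs_ge0 (rho h); have r0' := Cabs_ge0 (rho' h).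
set r := rho h in leB r0 *; set r' := rho' h in leB' r0' *.
have le_M (z : Cx) t b : Cabs t <= b -> Cabs (z * t)%R <= Cabs z * b.
  by move=> leb; rewrite CabsM; apply: Rmult_le_compat_l => //; exact: Cabs_ge0.
have rr : Cabs (r * r')%R <= B * B' by rewrite CabsM; apply: Rmult_le_compat.
apply: Cabs_add_le.
  apply: Cabs_add_le.
    by apply: Cabs_add_le; [apply: Cabs_add_le; exact: le_M | lra].
  have : Cabs (L * r' + L' * r)%R <= Cabs L * B' + Cabs L' * B.
    by apply: Cabs_add_le; exact: le_M.
  move=> leS; apply: Rle_trans (le_M h _ _ leS) _.
  rewrite -[X in _ <= X]Rmult_1_l; apply: Rmult_le_compat_r => //.
  exact: Rle_trans (Cabs_ge0 _) leS.
apply: Rle_trans (le_M _ _ _ rr) _; rewrite expr2 CabsM -[X in _ <= X]Rmult_1_l.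
by apply: Rmult_le_compat_r; [apply: Rmult_le_pos; lra | nra].
Qed.

(** With l = [ell x], the remainder is exact: 1/(l + hc) = 1/l - hc/l^2 + h^2 c^2/(l^2 (l + hc)).
    The radius keeps |l + hc| >= |l|/2. *)
Lemma expands_inv i (ell : vec -> Cx) c x :
  (forall h, ell (shift x i h) = ell x + h * c)%R -> ell x <> 0%R ->
  expands i (fun y => (ell y)^-1)%R x (- c * (ell x)^-1 * (ell x)^-1)%R.
Proof.
move=> lin xN0; have ell0 := Cabs_gt0 xN0; have c0 := Cabs_ge0 c.
exists (fun h => c ^+ 2 * (ell x)^-1 ^+ 2 * (ell x + h * c)^-1)%R.
exists (Cabs (c ^+ 2 * (ell x)^-1 ^+ 2)%R * / (Cabs (ell x) / 2)).
exists (Cabs (ell x) / (2 * (Cabs c + 1))); split; first by apply: Rdiv_lt_0_compat; lra.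
move=> h lt_h.
have {}lt_h : Cabs h * Cabs c <= Cabs (ell x) / 2.
  have := Rmult_lt_compat_r (Cabs c + 1) _ _ ltac:(lra) lt_h.
  have -> : Cabs (ell x) / (2 * (Cabs c + 1)) * (Cabs c + 1) = Cabs (ell x) / 2.
    by Rfield; lra.
  by have := Cabs_ge0 h; nra.
have big : Cabs (ell x) / 2 <= Cabs (ell x + h * c)%R.
  have := Cabs_add (ell x + h * c)%R (- (h * c))%R; rewrite addrK CabsN CabsM; lra.
have shN0 : (ell x + h * c)%R <> 0%R by move=> e; move: big; rewrite e Cabs0; lra.
split.
  rewrite lin; field.
  by apply/andP; split; apply/eqP.
rewrite CabsM CabsV; apply: Rmult_le_compat_l; first exact: Cabs_ge0.
by apply: Rinv_le_contravar; lra.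
Qed.

(** Derivatives are kept in logarithmic form, so that the q j simply add up and no product with an
    omitted factor appears. *)
Lemma expands_prod i (I : Type) (r : list I) (g : I -> vec -> Cx) (q : I -> Cx) x :
  (forall j, expands i (g j) x (g j x * q j)%R) ->
  expands i (fun y => \prod_(j <- r) g j y)%R x
    ((\prod_(j <- r) g j x) * \sum_(j <- r) q j)%R.
Proof.
move=> dg; elim: r => [|j r IHr].
  rewrite !big_nil mulr0; have := expands_cst i 1%R x.
  by apply: expands_ext; apply: near0_true => h; rewrite big_nil.
have := expands_mul (dg j) IHr; rewrite !big_cons.
set p := (\prod_(j <- r) g j x)%R; set s := (\sum_(j <- r) q j)%R.
have -> : (g j x * q j * p + g j x * (p * s) = g j x * p * (q j + s))%R by ring.
by apply: expands_ext; apply: near0_true => h; rewrite big_cons.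
Qed.

(** * Derivatives of f(sigma) off the hyperplanes *)

Section Recip.
Variables (n : nat) (sigma : mat).
Let ell j x := inner n x (col sigma j).

(** The algebra generated by the reciprocals of the linear forms. It is stable under partial
    derivatives, and its members are bounded wherever the forms stay away from 0. *)
Inductive recip_poly : (vec -> Cx) -> Prop :=
| recip_cst c : recip_poly (fun=> c)
| recip_inv j : (j < n)%N -> recip_poly (fun x => (ell j x)^-1)%R
| recip_add f g : recip_poly f -> recip_poly g -> recip_poly (fun x => f x + g x)%R
| recip_mul f g : recip_poly f -> recip_poly g -> recip_poly (fun x => f x * g x)%R.

Lemma recip_sum (I : Type) (r : list I) (F : I -> vec -> Cx) :
  (forall j, recip_poly (F j)) -> recip_poly (fun x => \sum_(j <- r) F j x)%R.
Proof.
move=> rF; elim: r => [|j r IHr].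
  have -> : (fun x => \sum_(j <- [::]) F j x)%R = (fun=> 0%R).
    by apply/funext => x; rewrite big_nil.
  exact: recip_cst.
have -> : (fun x => \sum_(k <- j :: r) F k x)%R
        = (fun x => F j x + \sum_(k <- r) F k x)%R.
  by apply/funext => x; rewrite big_cons.
exact: recip_add.
Qed.

Lemma colsP x : reflect (forall j, (j < n)%N -> ell j x <> 0%R) (all_cols_nonzero n x sigma).
Proof.
apply: (iffP (forallb_seqE _ _)) => H j /H; rewrite nonzeroCE; first by move/eqP.
by move=> ?; apply/eqP.
Qed.

Lemma ell_shift i j x h : (i < n)%N -> (ell j (shift x i h) = ell j x + h * sigma i j)%R.
Proof.
move=> ltin; rewrite /ell !innerE (bigD1 (Ordinal ltin)) //=.
rewrite [in RHS](bigD1 (Ordinal ltin)) //= /shift /upd Nat.eqb_refl mulrDl addrAC.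
congr (_ + _ + _)%R; apply: eq_bigr => k neq; case: Nat.eqb_spec => // ki.
by case/eqP: neq; apply: val_inj.
Qed.

Lemma expands_ellV i j x : (i < n)%N -> ell j x <> 0%R ->
  expands i (fun y => (ell j y)^-1)%R x (- sigma i j * (ell j x)^-1 * (ell j x)^-1)%R.
Proof. by move=> ltin; apply: expands_inv => h; exact: ell_shift. Qed.

Lemma recip_expands i f : (i < n)%N -> recip_poly f ->
  exists f', recip_poly f' /\
    forall x, all_cols_nonzero n x sigma -> expands i f x (f' x).
Proof.
move=> ltin; elim=> [c|j ltjn|g h rg [g' [rg' dg]] rh [h' [rh' dh]]
                    |g h rg [g' [rg' dg]] rh [h' [rh' dh]]].
- by exists (fun=> 0%R); split; [exact: recip_cst | move=> x _; exact: expands_cst].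
- exists (fun x => - sigma i j * (ell j x)^-1 * (ell j x)^-1)%R; split.
    by do 2?apply: recip_mul; [exact: recip_cst|exact: recip_inv..].
  by move=> x /colsP xN0; apply: expands_ellV => //; exact: xN0.
- exists (fun x => g' x + h' x)%R; split; first exact: recip_add.
  by move=> x xU; apply: expands_add; [exact: dg|exact: dh].
- exists (fun x => g' x * h x + g x * h' x)%R; split.
    by apply: recip_add; apply: recip_mul.
  by move=> x xU; apply: expands_mul; [exact: dg|exact: dh].
Qed.

Lemma near0_cols i x : (i < n)%N -> all_cols_nonzero n x sigma ->
  near0 (fun h => all_cols_nonzero n (shift x i h) sigma).
Proof.
move=> ltin /colsP xN0.
suff : near0 (fun h => forall j, (j < n)%N -> ell j (shift x i h) <> 0%R).
  by apply: near0_imp => h /colsP.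
apply: near0_all => j /xN0 jN0; have j0 := Cabs_gt0 jN0; have c0 := Cabs_ge0 (sigma i j).
(* Adding 1 covers the case sigma i j = 0. *)
exists (Cabs (ell j x) / (Cabs (sigma i j) + 1)); split; first by apply: Rdiv_lt_0_compat; lra.
move=> h lt_h; rewrite ell_shift // => /eqP; rewrite addr_eq0 => /eqP e.
have := Rmult_lt_compat_r (Cabs (sigma i j) + 1) _ _ ltac:(lra) lt_h.
have -> : Cabs (ell j x) / (Cabs (sigma i j) + 1) * (Cabs (sigma i j) + 1) = Cabs (ell j x).
  by Rfield; lra.
by rewrite e CabsN CabsM; have := Cabs_ge0 h; nra.
Qed.

Lemma fsig_prod x : all_cols_nonzero n x sigma ->
  fsig n sigma x = (det n sigma * \prod_(j < n) (ell j x)^-1)%R.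
Proof. by rewrite /fsig => ->; rewrite CdivE CprodE -prodfV. Qed.

Lemma fsig_expands i x : (i < n)%N -> all_cols_nonzero n x sigma ->
  expands i (fsig n sigma) x (fsig n sigma x * \sum_(j < n) - sigma i j * (ell j x)^-1)%R.
Proof.
move=> ltin xU; have xN0 := colsP _ xU.
have dprod := @expands_prod i _ (index_enum 'I_n) (fun j y => (ell j y)^-1)%R
  (fun j => - sigma i j * (ell j x)^-1)%R x.
have := expands_mul (expands_cst i (det n sigma) x) (dprod _).
rewrite mul0r add0r mulrA -fsig_prod // => H.
apply: expands_ext (H _); first by apply: near0_imp (near0_cols ltin xU) => h /fsig_prod.
move=> j; have := @expands_ellV i j x ltin (xN0 j (ltn_ord j)).
by rewrite mulrC mulrA.
Qed.

(** By the Leibniz rule, since the logarithmic derivative of [fsig] lies in the same algebra.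
    Knowing g off the hyperplanes is enough because their complement is open. *)
Lemma Cpartial_fsig i g f : (i < n)%N -> recip_poly f ->
  (forall x, all_cols_nonzero n x sigma -> g x = fsig n sigma x * f x)%R ->
  exists f', recip_poly f' /\
    forall x, all_cols_nonzero n x sigma -> (Cpartial i g x = fsig n sigma x * f' x)%R.
Proof.
move=> ltin rf gE; have [f' [rf' df]] := recip_expands ltin rf.
exists (fun x => (\sum_(j < n) - sigma i j * (ell j x)^-1) * f x + f' x)%R; split.
  apply: recip_add => //; apply: recip_mul => //; apply: recip_sum => j.
  by apply: recip_mul; [exact: recip_cst | exact: recip_inv].
move=> x xU; apply: Cpartial_eq.
apply: (@expands_ext i g (fun y => fsig n sigma y * f y)%R).
  by apply: near0_imp (near0_cols ltin xU) => h /gE.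
by rewrite mulrDr mulrA; apply: expands_mul; [exact: fsig_expands | exact: df].
Qed.

Lemma Dalpha_fsig alpha : exists f, recip_poly f /\
  forall x, all_cols_nonzero n x sigma ->
    (Dalpha n alpha (fsig n sigma) x = fsig n sigma x * f x)%R.
Proof.
rewrite /Dalpha; have : forall i, In i (List.seq 0 n) -> (i < n)%N.
  by move=> i /in_seq [_ /ltP].
elim: (List.seq 0 n) => [|i r IHr] ltn_r.
  by exists (fun=> 1%R); split; [exact: recip_cst | move=> x _; rewrite mulr1].
have [|f Hf] := IHr; first by move=> k kr; apply: ltn_r; right.
have ltin := ltn_r i (or_introl erefl).
rewrite /=; move: Hf; move: (fold_right _ _ r) => g Hf.
elim: (alpha i) => [|m [f' [rf' gE]]]; first by exists f.
exact: Cpartial_fsig gE.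
Qed.

Lemma fsigP_fsig P : exists f, recip_poly f /\
  forall x, all_cols_nonzero n x sigma -> (fsigP n sigma P x = fsig n sigma x * f x)%R.
Proof.
suff [f [rf fE]] : exists f, recip_poly f /\
  forall x, all_cols_nonzero n x sigma ->
    fold_right Cadd C0 (List.map (fun m => Cmul (fst m)
      (Cmul (Cpow_nat (Copp C1) (total_deg n (snd m)))
            (Dalpha n (snd m) (fsig n sigma) x))) P) = (fsig n sigma x * f x)%R.
  by exists f; split=> // x xU; rewrite /fsigP xU fE.
elim: P => [|m P [f [rf fE]]] /=.
  by exists (fun=> 0%R); split; [exact: recip_cst | move=> x _; rewrite mulr0].
have [g [rg gE]] := Dalpha_fsig m.2.
exists (fun x => m.1 * ((- 1) ^+ total_deg n m.2 * g x) + f x)%R; split.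
  by apply: recip_add => //; do 2?apply: recip_mul => //; exact: recip_cst.
by move=> x xU; rewrite fE // gE // !CE; ring.
Qed.

(** * Bounds away from the hyperplanes *)

Lemma recip_bounded f c : 0 < c -> recip_poly f -> exists B, 0 <= B /\
  forall x, (forall j, (j < n)%N -> c <= Cabs (ell j x)) -> Cabs (f x) <= B.
Proof.
move=> c0; elim=> [b|j ltjn|g h _ [B [B0 gB]] _ [B' [B0' hB]]|g h _ [B [B0 gB]] _ [B' [B0' hB]]].
- by exists (Cabs b); split; [exact: Cabs_ge0 | move=> *; lra].
- exists (/ c); split; first by left; apply: Rinv_0_lt_compat.
  by move=> x /(_ j ltjn) cle; rewrite CabsV; apply: Rinv_le_contravar.
- exists (B + B'); split=> [|x cle]; first by lra.
  by have := Cabs_add (g x) (h x); have := gB x cle; have := hB x cle; lra.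
- exists (B * B'); split=> [|x cle]; first by nra.
  by rewrite CabsM; apply: Rmult_le_compat; [exact: Cabs_ge0..|exact: gB|exact: hB].
Qed.

(** Cramer's rule without division: evaluate the product of x, sigma, its adjugate and v in two
    ways. *)
Lemma det_inner x v : (det n sigma * inner n x v
  = \sum_(j < n) ell j x * (\sum_(k < n) (\adj (mx_of n sigma)) j k * v k))%R.
Proof.
pose X := (\row_(j < n) x j)%R; pose V := (\col_(j < n) v j)%R.
have := congr1 (fun T => (X *m T *m V)%R) (mul_mx_adj (mx_of n sigma)).
move=> /(congr1 (fun T : 'M_1 => T ord0 ord0)).
rewrite mul_mx_scalar -scalemxAl -detE mulmxA -[(X *m _ *m _ *m V)%R]mulmxA => H.
transitivity ((det n sigma *: (X *m V)) ord0 ord0)%R.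
  rewrite mxE; congr (_ * _)%R; rewrite innerE mxE; apply: eq_bigr => j _.
  by rewrite !mxE.
rewrite -H mxE; apply: eq_bigr => j _; congr (_ * _)%R.
  by rewrite /ell innerE mxE; apply: eq_bigr => k _; rewrite !mxE.
by rewrite mxE; apply: eq_bigr => k _; rewrite !mxE.
Qed.

(* As [det sigma * <x, v>] is a combination of the [<x, sigma_j>], one factor of the
   denominator cancels; no case distinction on [det sigma] is needed. *)
Lemma fsig_inner_bounded v c : 0 < c -> exists B, 0 <= B /\
  forall x, (forall j, (j < n)%N -> c <= Cabs (ell j x)) ->
    Cabs (fsig n sigma x) * Cabs (inner n x v) <= B.
Proof.
move=> c0; pose b (j : 'I_n) := (\sum_(k < n) (\adj (mx_of n sigma)) j k * v k)%R.
have ic0 : 0 < / c by apply: Rinv_0_lt_compat.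
exists (\big[Rplus/0]_(j < n) (Cabs (b j) * \big[Rmult/1]_(l < n | l != j) / c)).
have p0 (j : 'I_n) : 0 < \big[Rmult/1]_(l < n | l != j) / c by apply: Rprod_gt0.
split.
  by apply: Rsum_ge0 => j _; apply: Rmult_le_pos; [exact: Cabs_ge0 | left].
move=> x cle.
have xN0 j : (j < n)%N -> ell j x <> 0%R by move=> /cle + e; rewrite e Cabs0; lra.
rewrite fsig_prod; last exact/colsP.
rewrite -CabsM mulrAC det_inner mulr_suml; apply: Rle_trans (Cabs_sum _) _.
apply: Rsum_le => j _; rewrite -/(b j) (bigD1 j) //=.
have -> y : (ell j x * b j * ((ell j x)^-1 * y) = b j * y)%R.
  by field; apply/eqP; exact: xN0.
rewrite CabsM; apply: Rmult_le_compat_l; first exact: Cabs_ge0.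
rewrite (big_morph Cabs CabsM Cabs1); apply: Rprod_le => l _; split; first exact: Cabs_ge0.
by rewrite CabsV; apply: Rinv_le_contravar => //; apply: cle.
Qed.

Lemma fsig_bounded c : 0 < c -> exists B, 0 <= B /\
  forall x, (forall j, (j < n)%N -> c <= Cabs (ell j x)) -> Cabs (fsig n sigma x) <= B.
Proof.
move=> c0; have ic0 : 0 < / c by apply: Rinv_0_lt_compat.
exists (Cabs (det n sigma) * \big[Rmult/1]_(l < n) / c); split.
  by apply: Rmult_le_pos; [exact: Cabs_ge0 | left; apply: Rprod_gt0].
move=> x cle; rewrite fsig_prod; last first.
  by apply/colsP => j /cle + e; rewrite e Cabs0; lra.
rewrite CabsM Cabs_prod; apply: Rmult_le_compat_l; first exact: Cabs_ge0.
apply: Rprod_le => l _; split; first exact: Cabs_ge0.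
by rewrite CabsV; apply: Rinv_le_contravar => //; apply: cle.
Qed.

(** Only nonvanishing factors have to be bounded below, as [fsigP] is 0 by definition when some
    factor vanishes. Elsewhere it is [fsig] times a bounded function. *)
Lemma fsigP_bounded P v c : 0 < c -> exists B, 0 <= B /\
  forall x, (forall j, (j < n)%N -> ell j x <> 0%R -> c <= Cabs (ell j x)) ->
    Cabs (fsigP n sigma P x) <= B /\ Cabs (fsigP n sigma P x) * Cabs (inner n x v) <= B.
Proof.
move=> c0; have [f [rf fE]] := fsigP_fsig P.
have [B1 [B10 fB]] := recip_bounded c0 rf.
have [B2 [B20 gB]] := fsig_bounded c0.
have [B3 [B30 hB]] := fsig_inner_bounded v c0.
exists (B1 * (B2 + B3)); split=> [|x cle]; first by nra.
case xU : (all_cols_nonzero n x sigma); last first.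
  by rewrite /fsigP xU C0E Cabs0; nra.
have {}cle j : (j < n)%N -> c <= Cabs (ell j x).
  by move=> ltjn; apply: cle => //; move: j ltjn; exact/colsP.
rewrite fE // CabsM.
have := fB x cle; have := gB x cle; have := hB x cle.
have := Cabs_ge0 (f x); have := Cabs_ge0 (fsig n sigma x); have := Cabs_ge0 (inner n x v).
move: (Cabs (f x)) (Cabs (fsig n sigma x)) (Cabs (inner n x v)) => a b e.
by move=> *; split; nra.
Qed.
End Recip.
End Derivatives.
Import Derivatives.

(** * Denominators and the norm form *)

(** This says that D z lies in Z[sqrt(-d)]; integrality is tracked through such explicit
    denominators. *)
Definition den (d : nat) (D : Z) (z : Cx) : Prop := exists a b : Z,
  re z * IZR D = IZR a /\ im z * IZR D = IZR b * sqrt (INR d).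

Section Denominators.
Variable d : nat.
Notation den := (den d).

Lemma den_inF D z : Z.lt 0 D -> den D z -> inF d z.
Proof.
move=> D0 [a [b [ea eb]]]; have D0' : 0 < IZR D by apply: IZR_lt.
exists (Qmake a (Z.to_pos D)), (Qmake b (Z.to_pos D)).
rewrite /QtoC /Q2R /= Z2Pos.id //; apply: Cx_eq => /=.
  by rewrite -ea; field; lra.
apply: (Rmult_eq_reg_r (IZR D)); last by lra.
by rewrite eb; field; lra.
Qed.

Lemma inF_den z : inF d z -> exists D, Z.lt 0 D /\ den D z.
Proof.
move=> [a [b ->]]; exists (Z.mul (Zpos (Qden a)) (Zpos (Qden b))); split; first by lia.
exists (Z.mul (Qnum a) (Zpos (Qden b))), (Z.mul (Qnum b) (Zpos (Qden a))).
have pos p : IZR (Zpos p) <> 0 by apply: not_0_IZR.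
by rewrite !mult_IZR /= /Q2R; split; field; repeat split; exact: pos.
Qed.

Lemma den_add D E z w : den D z -> den E w -> den (Z.mul D E) (z + w)%R.
Proof.
move=> [a [b [ea eb]]] [a' [b' [ea' eb']]].
exists (Z.add (Z.mul a E) (Z.mul a' D)), (Z.add (Z.mul b E) (Z.mul b' D)).
rewrite !plus_IZR !mult_IZR -ea -ea' /=; split; first by ring.
transitivity (im z * IZR D * IZR E + im w * IZR E * IZR D); first by ring.
by rewrite eb eb'; ring.
Qed.

Lemma den_mul D E z w : den D z -> den E w -> den (Z.mul D E) (z * w)%R.
Proof.
move=> [a [b [ea eb]]] [a' [b' [ea' eb']]].
have sq : sqrt (INR d) * sqrt (INR d) = IZR (Z.of_nat d).
  by rewrite sqrt_sqrt ?INR_IZR_INZ //; apply: IZR_le; lia.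
exists (Z.sub (Z.mul a a') (Z.mul (Z.mul b b') (Z.of_nat d))), (Z.add (Z.mul a b') (Z.mul b a')).
rewrite minus_IZR plus_IZR !mult_IZR -sq -ea -ea' /=; split.
  transitivity (re z * IZR D * (re w * IZR E) - im z * IZR D * (im w * IZR E)); first by ring.
  by rewrite eb eb'; ring.
transitivity (re z * IZR D * (im w * IZR E) + im z * IZR D * (re w * IZR E)); first by ring.
by rewrite eb eb'; ring.
Qed.

Lemma den_Z a : den 1 (ZtoC a).
Proof. by exists a, Z0; rewrite /=; split; ring. Qed.

Lemma inF0 : inF d 0%R.
Proof. by apply: (@den_inF (Zpos xH)) => //; exists Z0, Z0; rewrite /=; split; ring. Qed.

Lemma den_opp D z : den D z -> den D (- z)%R.
Proof.
move=> [a [b [ea eb]]]; exists (Z.opp a), (Z.opp b); rewrite !opp_IZR -ea /=.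
by split; [ring | transitivity (- (im z * IZR D)); [|rewrite eb]; ring].
Qed.

Lemma den_weaken D E z : den D z -> den (Z.mul D E) z.
Proof.
move=> [a [b [ea eb]]]; exists (Z.mul a E), (Z.mul b E); rewrite !mult_IZR -ea.
by split; [ring | transitivity (im z * IZR D * IZR E); [|rewrite eb]; ring].
Qed.

(** The square of D |z| is the integer a^2 + d b^2, which is positive and hence at least 1. *)
Lemma den_lower_bound D z : Z.lt 0 D -> den D z -> z <> 0%R -> / IZR D <= Cabs z.
Proof.
move=> D0 [a [b [ea eb]]] zN0; have D0' : 0 < IZR D by apply: IZR_lt.
have zD := Rmult_lt_0_compat _ _ (Cabs_gt0 zN0) D0'.
suff : 1 <= Cabs z * IZR D.
  move=> le1; apply: (Rmult_le_reg_r (IZR D)) => //.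
  by rewrite Rinv_l; lra.
have sq : (Cabs z * IZR D) * (Cabs z * IZR D)
    = IZR (Z.add (Z.mul a a) (Z.mul (Z.mul b b) (Z.of_nat d))).
  have : sqrt (INR d) * sqrt (INR d) = IZR (Z.of_nat d).
    by rewrite sqrt_sqrt ?INR_IZR_INZ //; apply: IZR_le; lia.
  have : Cabs z * Cabs z = Cnorm2 z by apply: sqrt_sqrt; exact: Cnorm2_ge0.
  rewrite plus_IZR !mult_IZR => zz <-.
  transitivity (Cnorm2 z * (IZR D * IZR D)); first by rewrite -zz; ring.
  transitivity ((re z * IZR D) * (re z * IZR D) + (im z * IZR D) * (im z * IZR D)).
    by rewrite /Cnorm2; ring.
  by rewrite ea eb; ring.
have pos : 0 < (Cabs z * IZR D) * (Cabs z * IZR D) by apply: Rmult_lt_0_compat.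
have : 1 <= (Cabs z * IZR D) * (Cabs z * IZR D).
  rewrite sq in pos *; apply: IZR_le; have := lt_IZR _ _ pos; lia.
nra.
Qed.

Lemma uniform_den n (S : nat -> Cx -> Prop) :
  (forall i, (i < n)%N -> exists D, Z.lt 0 D /\ forall z, S i z -> den D z) ->
  exists D, Z.lt 0 D /\ forall i, (i < n)%N -> forall z, S i z -> den D z.
Proof.
elim: n => [|n IHn] HS; first by exists (Zpos xH).
have [|D [D0 HD]] := IHn; first by move=> i ltin; apply: HS; apply: ltnW.
have [E [E0 HE]] := HS n (ltnSn n).
exists (Z.mul D E); split; first by lia.
move=> i; rewrite ltnS leq_eqVlt => /orP[/eqP->|ltin] z Sz.
  by rewrite Z.mul_comm; apply: den_weaken; exact: HE.
by apply: den_weaken; exact: HD Sz.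
Qed.

(** * Functions with bounded denominators *)

Section Preserving.
Variable n : nat.

Definition den_vec D (x : vec) := forall i, (i < n)%N -> den D (x i).

(** The new denominator depends on D alone, not on x. Polynomials over F have this property, and the
    closure lemmas below establish it without a type of polynomials. *)
Definition preserves_den (phi : vec -> Cx) := forall D, Z.lt 0 D ->
  exists E, Z.lt 0 E /\ forall x, den_vec D x -> den E (phi x).

Lemma preserves_cst z : inF d z -> preserves_den (fun=> z).
Proof. by move=> /inF_den [E [E0 Ez]] D _; exists E. Qed.

Lemma preserves_Z a : preserves_den (fun=> ZtoC a).
Proof. by move=> D _; exists (Zpos xH); split=> // x _; exact: den_Z. Qed.

Lemma preserves_coord i : (i < n)%N -> preserves_den (fun x => x i).
Proof. by move=> ltin D D0; exists D; split=> // x; apply. Qed.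

Lemma preserves_add f g : preserves_den f -> preserves_den g ->
  preserves_den (fun x => f x + g x)%R.
Proof.
move=> pf pg D D0; have [E [E0 fE]] := pf D D0; have [E' [E0' gE]] := pg D D0.
exists (Z.mul E E'); split; first by lia.
by move=> x xD; apply: den_add; [exact: fE | exact: gE].
Qed.

Lemma preserves_mul f g : preserves_den f -> preserves_den g ->
  preserves_den (fun x => f x * g x)%R.
Proof.
move=> pf pg D D0; have [E [E0 fE]] := pf D D0; have [E' [E0' gE]] := pg D D0.
exists (Z.mul E E'); split; first by lia.
by move=> x xD; apply: den_mul; [exact: fE | exact: gE].
Qed.

Lemma preserves_ext f g : (forall x, f x = g x) -> preserves_den f -> preserves_den g.
Proof. by move=> /funext ->. Qed.

Lemma preserves_sum (I : Type) (r : list I) (F : I -> vec -> Cx) :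
  (forall j, preserves_den (F j)) -> preserves_den (fun x => \sum_(j <- r) F j x)%R.
Proof.
move=> pF; elim: r => [|j r IHr].
  by apply: preserves_ext (preserves_Z 0) => x; rewrite big_nil.
by apply: preserves_ext (preserves_add (pF j) IHr) => x; rewrite big_cons.
Qed.

Lemma preserves_prod (I : Type) (r : list I) (F : I -> vec -> Cx) :
  (forall j, preserves_den (F j)) -> preserves_den (fun x => \prod_(j <- r) F j x)%R.
Proof.
move=> pF; elim: r => [|j r IHr].
  by apply: preserves_ext (preserves_Z 1) => x; rewrite big_nil.
by apply: preserves_ext (preserves_mul (pF j) IHr) => x; rewrite big_cons.
Qed.

(** By the Leibniz formula the determinant is a polynomial in its entries with coefficients 1 and
    -1. *)
Lemma preserves_det m (F : 'I_m -> 'I_m -> vec -> Cx) :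
  (forall i j, preserves_den (F i j)) ->
  preserves_den (fun x => \det (\matrix_(i, j) F i j x))%R.
Proof.
move=> pF.
apply: (@preserves_ext (fun x => \sum_(s : {perm 'I_m}) (-1) ^+ s * \prod_i F i (s i) x)%R).
  move=> x; apply: eq_bigr => s _; congr (_ * _)%R.
  by apply: eq_bigr => i _; rewrite mxE.
apply: preserves_sum => s; apply: preserves_mul; last by apply: preserves_prod => i; exact: pF.
case: (odd_perm s); last exact: (preserves_Z 1).
have -> : (fun _ : vec => ((-1) ^+ true)%R : Cx) = (fun=> ZtoC (-1)).
  by apply/funext => _; rewrite expr1; apply: Cx_eq => /=; lra.
exact: preserves_Z.
Qed.

Lemma preserves_inner v : (forall i, (i < n)%N -> inF d (v i)) ->
  preserves_den (fun x => inner n x v).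
Proof.
move=> vF; apply: (@preserves_ext (fun x => \sum_(i < n) x i * v i)%R).
  by move=> x; rewrite innerE.
by apply: preserves_sum => i; apply: preserves_mul; [exact: preserves_coord |
  apply: preserves_cst; exact: vF].
Qed.
End Preserving.

(** * The norm form of M *)

Section Norm.
Variables (n : nat) (M : mat).
Hypothesis hM : in_Rn d n M.

(** Additivity of [rho] is given on K only, so membership of the partial sums is carried along; the
    empty sum is handled by [rho] fixing F. *)
Lemma embedding_sum K rho m (F : 'I_m -> Cx) : subfield_containing_F d K ->
  embedding_fixing_F d K rho -> (forall i, K (F i)) ->
  K (\sum_i F i)%R /\ rho (\sum_i F i)%R = (\sum_i rho (F i))%R.
Proof.
move=> [KF [KD _]] [rhoD [_ [_ rhoF]]] KFi.
have F0 := inF0.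
elim/big_rec2: _ => [|i y z _ [Kz <-]]; first by split; [exact: KF | exact: rhoF].
by split; [exact: KD | exact: rhoD].
Qed.

Lemma embedding_scale K rho c z : subfield_containing_F d K ->
  embedding_fixing_F d K rho -> inF d c -> K z -> rho (c * z)%R = (c * rho z)%R.
Proof.
move=> [KF _] [_ [rhoM [_ rhoF]]] cF Kz; rewrite -{2}(rhoF c cF).
by apply: rhoM => //; exact: KF.
Qed.

Lemma ord_lt m (i : 'I_m) : (i < m)%coq_nat. Proof. exact/ltP. Qed.

(* The product of the conjugates of [sum_i x_i m_i] is the determinant of the
   multiplication by this element in an F-basis of K. *)
Lemma norm_form : preserves_den n (fun x => \prod_(l < n) inner n x (col M l))%R.
Proof.
have [detN0 [K [rho [m [subK [[b [Kb [span _]]] [emb [_ [Km Mrho]]]]]]]]] := hM.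
have [KF [KD [KM _]]] := subK.
have expand z : K z -> exists c : 'I_n -> Cx, (forall i, inF d (c i)) /\
    forall l : 'I_n, rho l z = (\sum_i c i * rho l (b i))%R.
  move=> /span[c [cF ->]]; exists (fun i : 'I_n => c i); split=> [i|l]; first exact: cF (ord_lt i).
  rewrite CsumE; have embl := emb l (ord_lt l).
  have [|_ ->] := embedding_sum (F := fun i : 'I_n => (c i * b i)%R) subK embl.
    by move=> i; apply: KM; [exact: KF (cF _ (ord_lt _)) | exact: Kb (ord_lt _)].
  apply: eq_bigr => i _.
  by apply: (embedding_scale subK embl); [exact: cF (ord_lt _) | exact: Kb (ord_lt _)].
have [c cP] := choice (fun i : 'I_n => expand (m i) (Km i (ord_lt i))).
have Kmb (p : 'I_n * 'I_n) : K (m p.1 * b p.2)%R.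
  by apply: KM; [exact: Km (ord_lt _) | exact: Kb (ord_lt _)].
have [beta betaP] := choice (fun p => expand _ (Kmb p)).
pose N := (\matrix_(i < n, l < n) rho l (b i))%R.
(* M is c times N, with c the F-coordinates of the m i, so det M <> 0 forces det N <> 0. *)
have detN : (\det N != 0)%R.
  apply/eqP => detN; apply: detN0; rewrite detE.
  suff -> : mx_of n M = (\matrix_(i, j) c i j *m N)%R by rewrite det_mulmx detN mulr0.
  apply/matrixP => i l; rewrite !mxE Mrho; try exact: ord_lt.
  by rewrite (cP i).2; apply: eq_bigr => j _; rewrite !mxE.
(* For x over F, row r holds the F-coordinates of b r times the sum of the x i * m i. The relation B
   N = N diag(<x, M_l>) is linear in x, so it holds for every x, and cancelling det N gives the
   norm. *)
pose B x := (\matrix_(r < n, j < n) \sum_(i < n) x i * beta (i, r) j)%R.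
apply: (@preserves_ext _ (fun x => \det (B x))%R); last first.
  apply: preserves_det => r j; apply: preserves_sum => i.
  by apply: preserves_mul; [exact: preserves_coord | apply: preserves_cst; exact: (betaP _).1].
move=> x; apply: (mulIf detN); rewrite -det_mulmx.
have -> : (B x *m N = N *m diag_mx (\row_l inner n x (col M l)))%R.
  apply/matrixP => r l; rewrite mul_mx_diag !mxE.
  under eq_bigr do rewrite !mxE mulr_suml.
  rewrite exchange_big /= innerE mulr_sumr; apply: eq_bigr => i _.
  rewrite /col Mrho; try exact: ord_lt.
  under eq_bigr do rewrite -mulrA.
  rewrite -mulr_sumr -((betaP (i, r)).2 l) /= mulrCA; congr (_ * _)%R.
  have [_ [rhoM _]] := emb l (ord_lt l).
  by rewrite [RHS]mulrC; apply: rhoM; [exact: Km (ord_lt _) | exact: Kb (ord_lt _)].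
rewrite det_mulmx det_diag mulrC; congr (_ * _)%R.
by apply: eq_bigr => l _; rewrite mxE.
Qed.

(** <x, M_l> is rho l of y, the sum of the x i * m i. Embeddings are injective, so one zero forces y
    = 0; then every <x, M_j> vanishes and invertibility of M gives x = 0. *)
Lemma inner_neq0 x : (forall i, (i < n)%N -> inF d (x i)) ->
  (exists2 i, (i < n)%N & x i <> 0%R) ->
  forall l, (l < n)%N -> inner n x (col M l) <> 0%R.
Proof.
move=> xF [i0 lti0 xi0] l ltl wl0.
have [detN0 [K [rho [m [subK [_ [emb [_ [Km Mrho]]]]]]]]] := hM.
have [KF [KD [KM [KN KV]]]] := subK.
have Kxm (i : 'I_n) : K (x i * m i)%R.
  by apply: KM; [exact: KF (xF _ (ltn_ord _)) | exact: Km (ord_lt _)].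
pose y := (\sum_(i < n) x i * m i)%R.
have wE j : (j < n)%N -> inner n x (col M j) = rho j y.
  move=> ltjn; have embj := emb j (elimT ltP ltjn).
  have [_ yE] := embedding_sum subK embj Kxm.
  rewrite [RHS]yE innerE; apply: eq_bigr => i _.
  rewrite /col (Mrho i j (ord_lt i) (elimT ltP ltjn)).
  by apply/esym/(embedding_scale subK embj); [exact: xF | exact: Km (ord_lt _)].
have Ky : K y by case: (embedding_sum subK (emb l (elimT ltP ltl)) Kxm).
have y0 : y = 0%R.
  apply: contrapT => yN0; have [_ [rhoM [rho1 _]]] := emb l (elimT ltP ltl).
  have := rhoM y _ Ky (KV y Ky yN0); rewrite -(wE l ltl) wl0.
  have -> : Cmul y (Cinv y) = C1 by exact: (divff (introN eqP yN0)).
  rewrite rho1 => /eqP; rewrite CmulE mul0r; exact/negP/C1_neq0.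
have w0 j : (j < n)%N -> inner n x (col M j) = 0%R.
  move=> ltjn; rewrite wE // y0; have [_ [_ [_ rhoF]]] := emb j (elimT ltP ltjn).
  by apply: rhoF; exact: inF0.
(* Pairing with the unit vector at [i0] isolates det M * x i0. *)
have := det_inner n M x (fun i => if (i == i0)%N then 1%R else 0%R).
rewrite [in RHS]big1 => [|j _]; last by rewrite w0 // mul0r.
move=> /eqP; rewrite mulf_eq0 => /orP[/eqP//|].
rewrite innerE (bigD1 (Ordinal lti0)) //= eqxx mulr1 big1 ?addr0 => [|j]; first by move/eqP.
by rewrite -val_eqE /= => /negbTE ->; rewrite mulr0.
Qed.
End Norm.
End Denominators.

(** * Absolute convergence *)

Lemma exp_le u v : u <= v -> exp u <= exp v.
Proof. by case=> [/exp_increasing|->]; lra. Qed.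

Lemma Cabs_pow_int z k : z <> 0%R -> Cabs (Cpow_int z k) = exp (IZR k * ln (Cabs z)).
Proof.
move=> zN0; have z0 := Cabs_gt0 zN0.
have pow m : Cabs (Cpow_nat z m) = exp (INR m * ln (Cabs z)).
  rewrite -/(Rpower _ _) Rpower_pow // CpowE.
  by elim: m => [|m IHm]; rewrite ?expr0 ?Cabs1 // exprS CabsM IHm.
case: k => [|p|p] /=; first by rewrite Rmult_0_l exp_0 -Cabs1.
  by rewrite pow INR_IZR_INZ positive_nat_Z.
rewrite [LHS]CabsV pow INR_IZR_INZ positive_nat_Z -exp_Ropp; congr exp.
by rewrite -Pos2Z.opp_pos opp_IZR; ring.
Qed.

Lemma Cabs_Rcpow r s : Cabs (Rcpow r s) = exp (re s * ln r).
Proof.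
rewrite /Cabs /Cnorm2 /=; set e := exp _; set t := im s * ln r.
have e0 : 0 <= e by left; exact: exp_pos.
rewrite -[RHS](sqrt_square e) //; congr sqrt.
by have := sin2_cos2 t; rewrite /Rsqr => sc; transitivity (e * e * (sin t * sin t + cos t * cos t));
  [ring | rewrite sc; ring].
Qed.

Lemma Cabs_Omega n s k x M : (forall i, (i < n)%N -> inner n x (col M i) <> 0%R) ->
  Cabs (Omega n s k x M) =
  exp (- (2 * re s - IZR k) * \big[Rplus/0]_(i < n) ln (Cabs (inner n x (col M i)))).
Proof.
move=> wN0; rewrite /Omega CprodE Cabs_prod -Rsum_scale exp_sum.
apply: eq_bigr => i _; rewrite CdivE CabsM CabsV Cabs_Rcpow Cabs_pow_int.
  rewrite Cabs_conj -exp_Ropp -exp_plus; congr exp; rewrite /=; ring.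
move=> /(congr1 Cabs); rewrite Cabs_conj Cabs0.
by have := Cabs_gt0 (wN0 i (ltn_ord i)); lra.
Qed.

(* The largest [l i] controls all the [|l i|] because their sum is bounded below. *)
Lemma decay_weight n (l : 'I_n -> R) g B p : (0 < n)%N -> 0 <= g -> 0 <= p -> p <= B ->
  (forall i, p * exp (l i) <= B) -> - g <= \big[Rplus/0]_i l i ->
  p <= B * exp (g / INR n - / (INR n * INR n) * \big[Rplus/0]_i Rabs (l i)).
Proof.
move=> n0 g0 p0 pB plB suml; have n0' : 0 < INR n by apply: lt_0_INR; apply/ltP.
(* m is the maximum of 0 and all the l i, so one of the given bounds yields p * exp m <= B. *)
have [m [m0 mB lem]] : exists m, [/\ 0 <= m, p * exp m <= B & forall i, l i <= m].
  suff [m [m0 mB lem]] : exists m,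
      [/\ 0 <= m, p * exp m <= B & forall i, i \in enum 'I_n -> l i <= m].
    by exists m; split=> // i; apply: lem; rewrite mem_enum.
  elim: (enum 'I_n) => [|j r [m [m0 mB lem]]].
    by exists 0; split=> //; rewrite ?exp_0; lra.
  case: (Rle_lt_dec (l j) m) => [lejm|ltmj].
    by exists m; split=> // i; rewrite inE => /orP[/eqP->|/lem].
  exists (l j); split=> //; first by lra.
  by move=> i; rewrite inE => /orP[/eqP->|/lem]; lra.
(* Every l i is at most m, and at least - g - n m because the other terms are at most m each. *)
have sum_le : \big[Rplus/0]_i Rabs (l i) <= INR n * (g + INR n * m).
  have -> : INR n * (g + INR n * m) = \big[Rplus/0]_(i < n) (g + INR n * m).
    by rewrite (Rsum_const predT) card_ord.
  apply: Rsum_le => i _; apply: Rabs_le.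
  have n1 : 1 <= INR n by apply: (le_INR 1); apply/leP.
  have := lem i; split; last by nra.
  suff : \big[Rplus/0]_j l j <= l i + INR n * m by lra.
  have -> : INR n * m = \big[Rplus/0]_(j < n) m by rewrite (Rsum_const predT) card_ord.
  rewrite (bigD1 i) //=; apply: Rplus_le_compat_l.
  rewrite [X in _ <= X](bigD1 i) //= -[X in X <= _]Rplus_0_l; apply: Rplus_le_compat => //.
  by apply: Rsum_le.
apply: (@Rle_trans _ (B * exp (- m))).
  apply: (Rmult_le_reg_r (exp m)); first exact: exp_pos.
  by rewrite Rmult_assoc -exp_plus Rplus_opp_l exp_0; lra.
apply: Rmult_le_compat_l; first by lra.
apply: exp_le; set S := \big[_/_]_(_ <- _ | _) _ in sum_le *.
have -> : - m = g / INR n - / (INR n * INR n) * (INR n * (g + INR n * m)) by field; lra.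
have := Rmult_le_compat_l (/ (INR n * INR n)) _ _ _ sum_le.
have : 0 < / (INR n * INR n) by apply: Rinv_0_lt_compat; nra.
move=> i0 /(_ (Rlt_le _ _ i0)); lra.
Qed.

(** The functions [fsig] coincide everywhere, which transfers all their derivatives at once. *)
Lemma fsigP_ext n sigma tau P x :
  (forall r c, (r < n)%N -> (c < n)%N -> sigma r c = tau r c) ->
  fsigP n sigma P x = fsigP n tau P x.
Proof.
move=> eq_st; have innE j y : (j < n)%N -> inner n y (col sigma j) = inner n y (col tau j).
  by move=> ltjn; rewrite !innerE; apply: eq_bigr => i _; rewrite /col eq_st.
have colsE y : all_cols_nonzero n y sigma = all_cols_nonzero n y tau.
  by apply/forallb_seqE/forallb_seqE => H j ltjn; have := H j ltjn; rewrite innE.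
have fE : fsig n sigma = fsig n tau.
  apply/funext => y; rewrite /fsig colsE !detE !CprodE.
  have -> : mx_of n sigma = mx_of n tau by apply/matrixP => r c; rewrite !mxE eq_st.
  by under eq_bigr do rewrite innE //.
by rewrite /fsigP fE colsE.
Qed.

Lemma uniform_bound (I : finType) (X : Type) (F : I -> X -> R) (S : X -> Prop) :
  (forall i, exists B, 0 <= B /\ forall x, S x -> F i x <= B) ->
  exists B, 0 <= B /\ forall i x, S x -> F i x <= B.
Proof.
move=> /choice[B HB]; exists (\big[Rplus/0]_i B i); split.
  by apply: Rsum_ge0 => i _; exact: (HB i).1.
move=> i x Sx; apply: Rle_trans ((HB i).2 x Sx) _.
by apply: le_Rsum_term => j; exact: (HB j).1.
Qed.

(** The selected columns vary with x, but only through finitely many matrices [sig f]. For each one,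
    the pairings of its columns with points of denominator D have a common denominator E, so the
    nonzero ones are at least 1/E. *)
Lemma psi_bounded d n frakA P M D : (0 < n)%N -> Z.lt 0 D ->
  (forall k, (k < n)%N -> in_GLn_F d n (frakA k)) ->
  exists B, 0 <= B /\ forall x, den_vec d n D x -> Cabs (psi n frakA P x) <= B /\
    forall m : 'I_n, Cabs (psi n frakA P x) * Cabs (inner n x (col M m)) <= B.
Proof.
move=> n0 D0 hA; pose i0 := Ordinal n0.
(* [insubd] sends column indices outside the range to [i0]; only those below n are compared
   later. *)
pose sig (f : {ffun 'I_n -> 'I_n}) : mat := fun r c => frakA c r (f (insubd i0 c)).
have sigF f j : (j < n)%N -> forall i, (i < n)%N -> inF d (col (sig f) j i).
  by move=> ltjn i ltin; apply: (hA j ltjn).1; exact/ltP.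
pose F (p : {ffun 'I_n -> 'I_n} * 'I_n) x :=
  Rmax (Cabs (fsigP n (sig p.1) P x))
       (Cabs (fsigP n (sig p.1) P x) * Cabs (inner n x (col M p.2))).
have [|B [B0 FB]] := @uniform_bound _ _ F (den_vec d n D).
  move=> [f m].
  have [|E [E0 HE]] := @uniform_den d n
      (fun j z => exists2 x, den_vec d n D x & z = inner n x (col (sig f) j)).
    move=> j ltjn; have [E [E0 HE]] := preserves_inner (sigF f j ltjn) D0.
    by exists E; split=> // _ [x xD ->]; exact: HE.
  have c0 : 0 < / IZR E by apply: Rinv_0_lt_compat; apply: IZR_lt.
  have [B [B0 HB]] := fsigP_bounded n (sig f) P (col M m) c0.
  exists B; split=> // x xD; have [|H1 H2] := HB x; last exact: Rmax_lub.
  by move=> j ltjn; apply: den_lower_bound => //; apply: HE ltjn _ _; exists x.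
exists B; split=> // x xD; rewrite /psi.
case: ifP => _; first by rewrite C0E Cabs0; split=> // m; rewrite Rmult_0_l.
(* The default index 0, returned when no column pairs nontrivially, is below n because n > 0. *)
have ltfn c : (first_nz n x (frakA c) < n)%N.
  rewrite /first_nz; case E: (List.find _ _) => [j|//].
  by have [/in_seq[_ /ltP]] := find_some _ _ E.
pose f := [ffun c : 'I_n => Ordinal (ltfn c)].
have -> : fsigP n (fun r c => frakA c r (first_nz n x (frakA c))) P x
        = fsigP n (sig f) P x.
  by apply: fsigP_ext => r c ltrn ltcn; rewrite /sig ffunE /= insubdK.
split=> [|m].
  by apply: Rle_trans (FB (f, i0) x xD); exact: Rmax_l.
by apply: Rle_trans (FB (f, m) x xD); exact: Rmax_r.
Qed.

Lemma shifted_lattice_den d n Lam u :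
  (forall i, (i < n)%N -> is_lattice_F d (Lam i)) -> (forall i, (i < n)%N -> inF d (u i)) ->
  exists D, Z.lt 0 D /\ forall x, in_shifted_lattice n Lam u x -> den_vec d n D x.
Proof.
move=> hL hu.
have [|D [D0 HD]] := @uniform_den d n (fun i z => Lam i (Csub z (u i))).
  move=> i ltin; have [w1 [w2 [/inF_den[D1 [D10 d1]] [/inF_den[D2 [D20 d2]] [_ LE]]]]] := hL i ltin.
  have [E [E0 dE]] := inF_den (hu i ltin).
  exists (Z.mul (Z.mul (Z.mul 1 D1) (Z.mul 1 D2)) E); split; first by lia.
  move=> z /LE[a [b zu]]; have -> : z = (z - u i + u i)%R by rewrite subrK.
  apply: den_add dE; rewrite -CsubE zu.
  by apply: den_add; apply: den_mul => //; exact: den_Z.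
by exists D; split=> // x [Lx _] i ltin; apply: HD (ltin) _ _; apply: Lx; exact/ltP.
Qed.

(** * From finite lists of lattice points to indexed sums *)

Lemma fold_right_nth (T : Type) (F : T -> R) (x0 : T) (l : list T) :
  fold_right Rplus 0 (List.map F l) = \big[Rplus/0]_(a < length l) F (List.nth a l x0).
Proof.
elim: l => [|x l IHl] /=; first by rewrite big_ord0.
by rewrite big_ord_recl IHl.
Qed.

Lemma fold_right_filter (T : Type) (F : T -> R) (p : T -> bool) (l : list T) :
  (forall x, p x = false -> F x = 0) ->
  fold_right Rplus 0 (List.map F l) = fold_right Rplus 0 (List.map F (List.filter p l)).
Proof.
move=> F0; elim: l => //= x l ->; case: ifP => //= /F0 ->; lra.
Qed.

(** The negation of the test in [psi]: all other terms of the series are 0. *)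
Definition nonzero_on n (x : vec) : bool :=
  ~~ forallb (fun i => negb (nonzeroC (x i))) (List.seq 0 n).

Lemma nonzero_onP n x : nonzero_on n x -> exists2 i, (i < n)%N & x i <> 0%R.
Proof.
move=> nz; apply: contrapT => no; move/negP: nz; apply; apply/forallb_seqE => i ltin.
by rewrite nonzeroCE negbK; apply/eqP; apply: contrapT => xi; apply: no; exists i.
Qed.

Lemma inner_sub n x y v : (inner n x v - inner n y v)%R = inner n (fun i => x i - y i)%R v.
Proof.
by rewrite !innerE -sumrB; apply: eq_bigr => i _; rewrite mulrBl.
Qed.

Lemma Psi_summable d n Lam frakA P u M k s :
  (forall i, (i < n)%N -> is_lattice_F d (Lam i)) ->
  (forall k, (k < n)%N -> in_GLn_F d n (frakA k)) ->
  (forall i, (i < n)%N -> inF d (u i)) -> in_Rn d n M -> re s > 1 + IZR k / 2 ->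
  abs_summable_on (in_shifted_lattice n Lam u) (Psi_term n frakA P s k M).
Proof.
move=> hL hA hu hM hs.
have term0 x : nonzero_on n x = false -> Cabs (Psi_term n frakA P s k M x) = 0.
  by rewrite /Psi_term /psi => /negbFE ->; rewrite CmulE C0E mul0r Cabs0.
(* For n = 0 every vector passes the zero test of [psi], so all terms are 0. *)
case: (posnP n) => [n0|n0].
  exists 0 => l _ _; rewrite (@fold_right_filter _ _ (nonzero_on n)) //.
  by rewrite n0 /nonzero_on /=; elim: l => //= *; lra.
have n0' : 0 < INR n by apply: lt_0_INR; apply/ltP.
have [D [D0 HD]] := shifted_lattice_den hL hu.
(* D * D is a denominator of differences of two points as well as of the points themselves. *)
pose D2 := Z.mul D D; have D20 : Z.lt 0 D2 by rewrite /D2; lia.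
pose w x i := inner n x (col M i).
have [E [E0 HE]] := norm_form hM D20.
have E1 : 1 <= IZR E by apply: IZR_le; lia.
(* Thus exp (- g) = 1/E is the lower bound for the norm of nonzero vectors. *)
pose g := ln (IZR E).
have g0 : 0 <= g.
  by rewrite /g -ln_1; case: E1 => [lt1|<-]; [left; apply: ln_increasing; lra | lra].
have expg : exp (- g) = / IZR E by rewrite exp_Ropp exp_ln //; lra.
have xF x : den_vec d n D2 x -> forall i, (i < n)%N -> inF d (x i).
  by move=> xD i /xD; exact: den_inF.
have normw x : den_vec d n D2 x -> nonzero_on n x ->
    (forall i : 'I_n, w x i <> 0%R) /\ exp (- g) <= \big[Rmult/1]_(i < n) Cabs (w x i).
  move=> xD /nonzero_onP nz; have wN0 := inner_neq0 hM (xF x xD) nz; split.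
    by move=> i; apply: wN0.
  rewrite expg -Cabs_prod; apply: den_lower_bound; [exact: E0 | exact: HE|].
  by apply/eqP/prodf_neq0 => i _; apply/eqP/wN0.
have normln x : den_vec d n D2 x -> nonzero_on n x ->
    - g <= \big[Rplus/0]_(i < n) ln (Cabs (w x i)).
  move=> xD nz; have [wN0 le_prod] := normw x xD nz.
  apply: Rnot_lt_le => /exp_increasing; apply: Rle_not_lt.
  by rewrite exp_sum (eq_bigr (fun i : 'I_n => Cabs (w x i))) // => i _;
    rewrite exp_ln //; apply: Cabs_gt0; exact: wN0.
have [B [B0 psiB]] := psi_bounded P M n0 D0 hA.
pose t := 2 * re s - IZR k; have t2 : 2 < t by rewrite /t; lra.
pose del := / (INR n * INR n); have del0 : 0 < del by apply: Rinv_0_lt_compat; nra.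
pose weight x := \big[Rmult/1]_(i < n)
  exp (- 2 * ln (Cabs (w x i)) - del * Rabs (ln (Cabs (w x i)))).
(* B exp (g / n) comes from the decay of [psi]; exp ((t - 2) g) pays for lowering the exponent of
   [Omega] from t to 2, the logarithms having sum at least - g. *)
pose C := B * exp (g / INR n) * exp ((t - 2) * g).
have C0 : 0 <= C by do 2?apply: Rmult_le_pos => //; left; exact: exp_pos.
have D2D x : den_vec d n D x -> den_vec d n D2 x.
  by move=> xD i ltin; apply: den_weaken; exact: xD.
have term_le x : den_vec d n D x -> nonzero_on n x ->
    Cabs (Psi_term n frakA P s k M x) <= C * weight x.
  move=> xD nz; have [wN0 _] := normw x (D2D x xD) nz.
  have suml := normln x (D2D x xD) nz; have [pB pwB] := psiB x xD.
  rewrite /Psi_term CmulE CabsM Cabs_Omega => [|i ltin]; last exact: (wN0 (Ordinal ltin)).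
  have := @decay_weight n (fun i => ln (Cabs (w x i))) g B _ n0 g0 (Cabs_ge0 _) pB _ suml.
  have pw (i : 'I_n) : Cabs (psi n frakA P x) * exp (ln (Cabs (w x i))) <= B.
    by rewrite exp_ln; [exact: pwB | apply: Cabs_gt0; exact: wN0].
  move=> /(_ pw) le_psi.
  apply: Rle_trans (Rmult_le_compat_r _ _ _ (Rlt_le _ _ (exp_pos _)) le_psi) _.
  rewrite /C /weight -exp_sum !Rmult_assoc; apply: Rmult_le_compat_l => //.
  rewrite -!exp_plus; apply: exp_le; rewrite -/(w x).
  rewrite big_split /= Rsum_scale -(big_morph Ropp Ropp_plus_distr Ropp_0) Rsum_scale.
  move: suml; rewrite -/del /w -/t.
  set S := \big[Rplus/0]_(i < n) ln _; set S' := \big[Rplus/0]_(i < n) Rabs _.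
  by move=> suml; have := Rmult_le_compat_l (t - 2) _ _ ltac:(lra) suml; lra.
exists (C * (49 ^ n * exp (2 * (g + INR n)) * (2 / (1 - exp (- del))) ^ n)) => l uniq_l lS.
rewrite (@fold_right_filter _ _ (nonzero_on n)) //.
set l' := List.filter _ l.
have uniq_l' : NoDup l' by apply: NoDup_filter.
have l'S x : In x l' -> in_shifted_lattice n Lam u x /\ nonzero_on n x.
  by move=> /filter_In[/lS ? ?].
rewrite (fold_right_nth _ (fun=> 0%R)); pose pt (a : 'I_(length l')) := List.nth a l' (fun=> 0%R).
have ptS a : in_shifted_lattice n Lam u (pt a) /\ nonzero_on n (pt a).
  by apply: l'S; apply: nth_In; exact: ord_lt.
have ptD a : den_vec d n D (pt a) by apply: HD; case: (ptS a).
apply: (@Rle_trans _ (\big[Rplus/0]_a (C * weight (pt a)))).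
  by apply: Rsum_le => a _; exact: term_le (ptD a) (ptS a).2.
rewrite Rsum_scale; apply: Rmult_le_compat_l => //.
apply: (@lattice_sum_le _ n (fun a (i : 'I_n) => w (pt a) i) g del n0 del0).
- by move=> a; apply: normln; [exact: D2D | case: (ptS a)].
- by move=> a; apply: (normw _ _ _).1; [exact: D2D | case: (ptS a)].
move=> a b neq_ab.
have diffD : den_vec d n D2 (fun i => pt a i - pt b i)%R.
  by move=> i ltin; apply: den_add; [|apply: den_opp]; apply: ptD.
(* Points that agree below n are equal as functions, since both are 0 from n on; [NoDup] then
   identifies their indices. *)
have nz : nonzero_on n (fun i => pt a i - pt b i)%R.
  apply/negP => /forallb_seqE eq_ab.
  move/eqP: neq_ab; apply; apply: val_inj.
  apply: (proj1 (NoDup_nth l' (fun=> 0%R)) uniq_l'); try exact: ord_lt.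
  apply/funext => i; rewrite -/(pt a) -/(pt b).
  case: (ltnP i n) => [/eq_ab|leni].
    by rewrite nonzeroCE negbK subr_eq0 => /eqP.
  have [[_ a0] _] := ptS a; have [[_ b0] _] := ptS b.
  by rewrite a0 ?b0 //; exact/leP.
have [_] := normw _ diffD nz; rewrite /w.
by under [X in _ -> _ <= X]eq_bigr do rewrite inner_sub.
Qed.

Lemma ltn_lt i n : (i < n)%N -> (i < n)%coq_nat.
Proof. by move/ltP. Qed.

End PsiSeries.

Theorem theorem3 (d : nat) (hd : (0 < d)%nat) (n : nat)
  (Lam : nat -> Cx -> Prop)
  (hLam : forall i, (i < n)%nat -> is_lattice_F d (Lam i) /\ multiplier_ring_is_OF d (Lam i))
  (frakA : nat -> mat) (hA : forall k, (k < n)%nat -> in_GLn_F d n (frakA k))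
  (P : mpoly) (hP : homogeneous n P)
  (u : vec) (hu : forall i, (i < n)%nat -> inF d (u i))
  (M : mat) (hM : in_Rn d n M)
  (k : Z) (s : Cx) (hs : re s > 1 + IZR k / 2) :
  abs_summable_on (in_shifted_lattice n Lam u) (Psi_term n frakA P s k M).
Proof.
apply PsiSeries.Psi_summable with (d := d); try assumption;
  intros i lt_i; apply PsiSeries.ltn_lt in lt_i; auto.
exact (proj1 (hLam i lt_i)).
Qed.
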